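(* Assuming the Continuum Hypothesis, there is a compact (Hausdorff) space $K$ such that $Seq^1(\mathrm{co}\,\Delta_K)\neq Seq(\mathrm{co}\,\Delta_K)=P(K)$.
   Context: For a compact space $K$, $M(K)=C(K)^*$ is the space of Radon signed measures on $K$ with the weak$^*$ topology, $P(K)$ is the set of Radon probability measures, $\delta_t$ is the Dirac measure at $t\in K$, $\Delta_K=\{\delta_t:t\in K\}$, and $\mathrm{co}\,\Delta_K$ is its convex hull. For $A\subseteq M(K)$: $Seq^0(A)=A$, $Seq^{\alpha+1}(A)$ is the set of limits of weak$^*$-convergent sequences in $Seq^\alpha(A)$, $Seq^\alpha(A)=\bigcup_{\beta<\alpha}Seq^\beta(A)$ for limit $\alpha$, and $Seq(A)=Seq^{\omega_1}(A)$ is the sequential closure of $A$ (the smallest subset of $M(K)$ containing $A$ and closed under limits of weak$^*$-convergent sequences). *)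

(* Defs.v *)
From HB Require Import structures.
From mathcomp Require Import all_boot all_order all_algebra.
From mathcomp Require Import all_classical all_reals topology normedtype sequences.
Unset Printing Implicit Defensive.
Import Order.TTheory GRing.Theory Num.Theory.
Import numFieldNormedType.Exports.
Local Open Scope classical_set_scope.
Local Open Scope ring_scope.

Definition CK (R : realType) (K : topologicalType) :=
  {f : K -> R^o | continuous f}.

(* Linear functionals on C(K) (linearity stated pointwise, so no algebraic
   structure on CK is needed). *)
Definition lin_functional (R : realType) (K : topologicalType)
  (phi : CK R K -> R) : Prop :=
  forall (a b : R) (f g h : CK R K),
    (forall x, sval h x = a * sval f x + b * sval g x) ->
    phi h = a * phi f + b * phi g.

Definition bdd_functional (R : realType) (K : topologicalType)
  (phi : CK R K -> R) : Prop :=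
  exists c : R, forall (f : CK R K) (M : R),
    (forall x, `|sval f x| <= M) -> `|phi f| <= c * M.

Definition MK (R : realType) (K : topologicalType) : set (CK R K -> R) :=
  [set phi | lin_functional R K phi /\ bdd_functional R K phi].

(* P(K): probability Radon measures = positive normalized functionals
   (Riesz–Markov) *)
Definition PK (R : realType) (K : topologicalType) : set (CK R K -> R) :=
  [set phi | MK R K phi /\
     (forall f : CK R K, (forall x, 0 <= sval f x) -> 0 <= phi f) /\
     (forall f : CK R K, (forall x, sval f x = 1) -> phi f = 1)].

Definition dirac_fun (R : realType) (K : topologicalType) (t : K) :
  CK R K -> R := fun f => sval f t.

Definition coDelta (R : realType) (K : topologicalType) : set (CK R K -> R) :=
  [set phi | exists (n : nat) (t : 'I_n -> K) (a : 'I_n -> R),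
     (forall i, 0 <= a i) /\ \sum_(i < n) a i = 1 /\
     phi = (fun f => \sum_(i < n) a i * dirac_fun R K (t i) f)].

Definition wstar_cvg (R : realType) (K : topologicalType)
  (u : nat -> (CK R K -> R)) (mu : CK R K -> R) : Prop :=
  forall f : CK R K, (fun n => u n f) @ \oo --> mu f.

Definition Seq1 (R : realType) (K : topologicalType) (A : set (CK R K -> R))
  : set (CK R K -> R) :=
  [set mu | MK R K mu /\
     exists u : nat -> (CK R K -> R), (forall n, A (u n)) /\ wstar_cvg R K u mu].

Definition seq_closed (R : realType) (K : topologicalType)
  (B : set (CK R K -> R)) : Prop :=
  B `<=` MK R K /\ Seq1 R K B `<=` B.

Definition SeqCl (R : realType) (K : topologicalType) (A : set (CK R K -> R))
  : set (CK R K -> R) :=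
  [set mu | forall B, seq_closed R K B -> A `<=` B -> B mu].

Definition CH (R : realType) : Prop :=
  forall A : set R, countable A \/ ([set: R] #<= A)%card.

(* Main.v *)
Require Import Defs.
From HB Require Import structures.
From mathcomp Require Import all_boot all_order all_algebra.
From mathcomp Require Import all_classical all_reals topology normedtype sequences.
From mathcomp Require Import wochoice ring lra.
Set Implicit Arguments.
Unset Strict Implicit.
Unset Printing Implicit Defensive.
Import Order.TTheory GRing.Theory Num.Theory.
Import numFieldNormedType.Exports.
Local Open Scope classical_set_scope.
Local Open Scope ring_scope.

(** Periodic subsets of [nat] are the clopen subsets of the profinite integers,
    with density as Haar measure, which is nonatomic.  So a subset of
    [nat * nat] with periodic rows is a sequence of clopen subsets of copies of
    the profinite integers; [lam n] is Haar measure on the [n]-th copy and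
    [mu = lim lam n].  The space is the Stone space of an algebra [B] of such
    subsets on which the limit exists.

    [B] is generated by the sets with eventually constant rows and by sets
    [A w], where [w] runs over a well-order of type omega_1.  The set [A w] has
    [mu]-measure at least 1/2, yet (up to finitely many rows) it misses a member
    of each of the countably many [mu]-null sequences of sets given before [w],
    and it misses finite sets of points given before [w] in the copies.  By CH
    all such data are listed.

    Any sequence of finitely supported measures is thus almost negligible on
    some [A w], so it cannot converge to [mu].  On the other hand a closed
    [mu]-null set is split by only countably many of the [A w], hence is
    metrizable and carries only limits of finitely supported measures.  This
    applies to [lam n], and puts [mu] and its densities in the sequential
    closure; since the clopen subsets of the profinite integers are [mu]-dense
    in [B], every measure absolutely continuous with respect to [mu] is a limit
    of such densities.  The Lebesgue decomposition takes care of all other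
    measures. *)

(** * Stone spaces of fields of sets *)

Section FieldsOfSets.
Variable T : Type.
Implicit Types a b : T -> bool.

Definition btop : T -> bool := fun=> true.
Definition bneg a : T -> bool := fun x => ~~ a x.
Definition band a b : T -> bool := fun x => a x && b x.
Definition bor a b : T -> bool := fun x => a x || b x.
Definition bxor a b : T -> bool := fun x => a x (+) b x.

Record boolalg := BoolAlg {
  balg :> (T -> bool) -> Prop;
  balgT : balg btop;
  balgN : forall a, balg a -> balg (bneg a);
  balgI : forall a b, balg a -> balg b -> balg (band a b) }.

Variable B : boolalg.

Lemma balgU a b : B a -> B b -> B (bor a b).
Proof.
move=> Ba Bb; have -> : bor a b = bneg (band (bneg a) (bneg b)).
  by apply/funext => x; rewrite /bor /bneg /band -negb_or negbK.
by apply: balgN; apply: balgI; apply: balgN.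
Qed.

Lemma balgX a b : B a -> B b -> B (bxor a b).
Proof.
move=> Ba Bb; have -> : bxor a b = bor (band a (bneg b)) (band (bneg a) b).
  by apply/funext => x; rewrite /bxor /bor /bneg /band; case: (a x); case: (b x).
by apply: balgU; apply: balgI => //; apply: balgN.
Qed.

Lemma balg0 : B (bneg btop).
Proof. by apply/balgN/balgT. Qed.

(* Points are extended by [false] outside [B], so that they are determined by
   their values on [B]. *)
Record stone := Stone {
  stpt :> (T -> bool) -> bool;
  stpt_sub : forall a, stpt a -> B a;
  stptN : forall a, B a -> stpt (bneg a) = ~~ stpt a;
  stptI : forall a b, B a -> B b -> stpt (band a b) = stpt a && stpt b }.

HB.instance Definition _ := gen_eqMixin stone.
HB.instance Definition _ := gen_choiceMixin stone.

Lemma stone_ext (p q : stone) : (forall a, B a -> p a = q a) -> p = q.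
Proof.
case: p q => [p p1 p2 p3] [q q1 q2 q3] /= pq.
have E : p = q.
  apply/funext => a; have [Ba|nBa] := pselect (B a); first exact: pq.
  by apply/idP/idP => [/p1|/q1].
by subst q; congr Stone; apply: Prop_irrelevance.
Qed.

Lemma stptT (p : stone) : p btop.
Proof.
have E : bneg btop = band btop (bneg btop) :> (T -> bool) by apply/funext.
have := stptI p (balgT B) (balg0).
by rewrite -E stptN; [case: (p btop)|exact: balgT].
Qed.

Lemma stpt0 (p : stone) : p (bneg btop) = false.
Proof. by rewrite stptN ?stptT//; exact: balgT. Qed.

Definition stone_open (O : set stone) :=
  forall p, O p -> exists2 a, p a & forall q : stone, q a -> O q.

Lemma stone_openT : stone_open setT.
Proof. by move=> p _; exists btop => //; exact: stptT. Qed.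

Lemma stone_openI : setI_closed stone_open.
Proof.
move=> X Y oX oY p [/oX[a pa aX] /oY[b pb bY]].
have [Ba Bb] := (stpt_sub pa, stpt_sub pb).
exists (band a b); first by rewrite stptI// pa.
by move=> q; rewrite stptI// => /andP[qa qb]; split; [exact: aX|exact: bY].
Qed.

Lemma stone_open_bigU (I : Type) (f : I -> set stone) :
  (forall i, stone_open (f i)) -> stone_open (\bigcup_i f i).
Proof.
by move=> fo p [i _ /fo[a pa aX]]; exists a => // q /aX ?; exists i.
Qed.

HB.instance Definition _ := isOpenTopological.Build stone
  stone_openT stone_openI stone_open_bigU.

Lemma open_clopen a : open [set p : stone | p a].
Proof. by move=> p pa; exists a. Qed.

Lemma stone_hausdorff : hausdorff_space stone.
Proof.
move=> p q pq; apply: contrapT => npq.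
have [a Ba pqa] : exists2 a, B a & p a <> q a.
  apply: contrapT => h; apply: npq; apply: stone_ext => a Ba.
  by apply: contrapT => ?; apply: h; exists a.
have ha (r : stone) : nbhs r [set s : stone | s a = r a].
  apply: open_nbhs_nbhs; split => //.
  case: (boolP (r a)) => ra.
    by have -> : [set s : stone | s a = true] = [set s : stone | s a];
      [by []|exact: open_clopen].
  have -> : [set s : stone | s a = false] = [set s : stone | s (bneg a)].
    by apply/seteqP; split => s /=; rewrite stptN//; case: (s a).
  exact: open_clopen.
have [s [/= sp sq]] := pq _ _ (ha p) (ha q).
by apply: pqa; rewrite -sp -sq.
Qed.

(** An ultrafilter [F] converges to the point whose value at [a] records whether the clopen set of
    [a] belongs to [F]. *)
Lemma stone_compact : compact [set: stone].
Proof.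
rewrite compact_ultra => F UF _.
pose P a := [set q : stone | q a].
have FN a : B a -> F (P (bneg a)) <-> ~ F (P a).
  move=> Ba; have -> : P (bneg a) = ~` P a.
    apply/seteqP; split => q /=; rewrite /P/= stptN//; last by move/negP.
    by move/negP.
  split => [h1 h2|]; first by have [q []] := filter_ex (filterI h1 h2).
  by case: (in_ultra_setVsetC (P a) UF).
pose p a := `[< B a /\ F (P a) >].
have p1 a : p a -> B a by move=> /asboolP[].
have p2 a : B a -> p (bneg a) = ~~ p a.
  move=> Ba; apply/idP/idP => [/asboolP[_ /FN h]|/negP h].
    by apply/negP => /asboolP[_ /h].
  apply/asboolP; split; first exact: balgN.
  by apply/FN => // h'; apply: h; apply/asboolP.
have p3 a b : B a -> B b -> p (band a b) = p a && p b.
  move=> Ba Bb; have E : P (band a b) = P a `&` P b.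
    by apply/seteqP; split => q; rewrite /P/= stptI// => /andP.
  apply/idP/idP => [/asboolP[_]|/andP[/asboolP[_ h1] /asboolP[_ h2]]].
    rewrite E => h; apply/andP; split; apply/asboolP; split => //.
      by apply: filterS h => q [].
    by apply: filterS h => q [].
  by apply/asboolP; rewrite E; split; [exact: balgI|exact: filterI].
exists (Stone p1 p2 p3); split => // O.
rewrite nbhsE /= => -[V [oV Vp] VO].
have [a /asboolP[_ Fa] aV] := oV _ Vp.
by apply: filterS Fa => q /aV/VO.
Qed.

(** The principal ultrafilter at [x]; the guard enforces the value false outside [B]. *)
Program Definition evpt (x : T) : stone :=
  @Stone (fun a => `[< B a >] && a x) _ _ _.
Next Obligation. by move=> x a /andP[/asboolP]. Qed.
Next Obligation.
move=> x a Ba; have -> : `[< B a >] by apply/asboolP.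
by have -> : `[< B (bneg a) >] by apply/asboolP; apply: balgN.
Qed.
Next Obligation.
move=> x a b Ba Bb; have -> : `[< B a >] by apply/asboolP.
have -> : `[< B b >] by apply/asboolP.
by have -> : `[< B (band a b) >] by apply/asboolP; apply: balgI.
Qed.

Lemma evptE x a : B a -> evpt x a = a x.
Proof. by move=> Ba; rewrite /evpt /=; have -> : `[< B a >] by apply/asboolP. Qed.

End FieldsOfSets.
Arguments btop {T}.

(** * Functionals and finitely additive measures *)

Lemma cvg_of_approx (R : realType) (u : nat -> R) (l : R) :
  (forall e : R, 0 < e -> exists v l', [/\ v @ \oo --> l',
     forall k, `|u k - v k| <= e & `|l - l'| <= e]) ->
  u @ \oo --> l.
Proof.
move=> h; apply/cvgrPdist_le => e e0.
have e3 : 0 < e / 3 by rewrite divr_gt0.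
have [v [l' [/cvgrPdist_le/(_ _ e3) vl uv ll]]] := h _ e3.
near=> k.
have h1 : `|l' - v k| <= e / 3 by near: k.
have := uv k; move: ll h1; rewrite !ler_norml.
by move=> /andP[? ?] /andP[? ?] /andP[? ?]; apply/andP; split; lra.
Unshelve. all: by end_near. Qed.

Lemma is_cvg_of_approx (R : realType) (u : nat -> R) :
  (forall e : R, 0 < e -> exists2 v, cvgn v & forall k, `|u k - v k| <= e) ->
  cvgn u.
Proof.
move=> h; apply/cauchy_cvgP/cauchy_exP => e e0.
have e3 : 0 < e / 3 by rewrite divr_gt0.
have [v /cvgrPdist_lt/(_ _ e3) vl uv] := h _ e3.
exists (lim (v @ \oo)); rewrite /fmap/=; near=> k; rewrite /ball/=.
have h1 : `|lim (v @ \oo) - v k| < e / 3 by near: k.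
have := uv k; move: h1; rewrite !ler_norml !ltr_norml.
by move=> /andP[? ?] /andP[? ?]; apply/andP; split; lra.
Unshelve. all: by end_near. Qed.

Section Functionals.
Variables (R : realType) (T : Type) (B : boolalg T).
Implicit Types (a b : T -> bool) (m : (T -> bool) -> R).
Let K : topologicalType := stone B.
Implicit Types (f g : CK R K) (phi : CK R K -> R).

Lemma lin_continuous (c d : R) f g :
  continuous (fun x => c * sval f x + d * sval g x : R^o).
Proof.
have fc := proj2_sig f; have gc := proj2_sig g.
move=> x; apply: (@continuousD R R^o K (fun x => c * sval f x) (fun x => d * sval g x)).
  by apply: (@continuousM R K (cst c)); [exact: cst_continuous|exact: fc].
by apply: (@continuousM R K (cst d)); [exact: cst_continuous|exact: gc].
Qed.

Definition linCK (c d : R) f g : CK R K := exist _ _ (@lin_continuous c d f g).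

Lemma ind_continuous a : continuous (fun p : K => (p a)%:R : R^o).
Proof.
move=> p; have h (b : bool) (q : K) : q a = b -> nbhs q [set r : K | r a = b].
  (* Outside [B] every point takes the value false, so the function is constant. *)
  have [Ba|nBa] := pselect (B a); last first.
    have E r : (r : stone B) a = false by apply/negP => /stpt_sub.
    by rewrite E => <-; apply: filterS filterT => r _; exact: E.
  move=> qa; apply: open_nbhs_nbhs; split => //.
  case: b qa => qa; first exact: open_clopen.
  have -> : [set s : K | s a = false] = [set s : K | s (bneg a)].
    by apply/seteqP; split => s /=; rewrite stptN//; case: (s a).
  exact: open_clopen.
move=> V /= /nbhs_singleton Vp; apply: filterS (h _ _ erefl) => q /= qa.
by rewrite qa.
Qed.

Definition ind a : CK R K := exist _ _ (@ind_continuous a).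

Definition step (s : seq (R * (T -> bool))) : CK R K :=
  foldr (fun x f => linCK x.1 1 (ind x.2) f) (linCK 0 0 (ind btop) (ind btop)) s.

Lemma stepE s (p : K) : sval (step s) p = \sum_(x <- s) x.1 * (p x.2)%:R.
Proof.
elim: s => [|x s /= ->]; first by rewrite big_nil /= !mul0r addr0.
by rewrite big_cons mul1r.
Qed.

Lemma lin_step phi s : lin_functional R K phi ->
  phi (step s) = \sum_(x <- s) x.1 * phi (ind x.2).
Proof.
move=> L; elim: s => [|x s IH].
  by rewrite big_nil (L 0 0 (ind btop) (ind btop)) ?mul0r ?addr0.
rewrite big_cons -IH -[in RHS](mul1r (phi (step s))).
by apply: L => p.
Qed.

Lemma step_restrict (s : seq (R * (T -> bool))) a (p : K) : B a ->
  (forall x, x \in s -> B x.2) ->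
  sval (step [seq (x.1, band x.2 a) | x <- s]) p = sval (step s) p * (p a)%:R.
Proof.
move=> Ba sB; rewrite !stepE big_map /= mulr_suml big_seq [RHS]big_seq.
apply: eq_bigr => x xs; rewrite stptI//; last exact: sB.
by rewrite -mulnb natrM mulrA.
Qed.

(** Density of step functions, by compactness. The sets over which [f] is approximable are closed
    under unions; if none of them were everything, their complements would generate a proper filter.
    At a cluster point of it, continuity makes a constant approximate [f] nearby, a
    contradiction. *)
Lemma approx_step f (e : R) : 0 < e ->
  exists2 s : seq (R * (T -> bool)), (forall x, x \in s -> B x.2) &
    forall p, `|sval f p - sval (step s) p| <= e.
Proof.
move=> e0; apply: contrapT => nex.
pose ok a := B a /\ exists2 s : seq (R * (T -> bool)), (forall x, x \in s -> B x.2) &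
    forall p : K, p a -> `|sval f p - sval (step s) p| <= e.
have okU a b : ok a -> ok b -> ok (bor a b).
  move=> [Ba [s sB hs]] [Bb [t tB ht]]; split; first exact: balgU.
  have BN := balgN Ba.
  exists ([seq (x.1, band x.2 a) | x <- s] ++ [seq (x.1, band x.2 (bneg a)) | x <- t]).
    move=> x; rewrite mem_cat => /orP[] /mapP[y ys ->] /=; apply: balgI => //.
      exact: sB.
    exact: tB.
  move=> p; rewrite stepE big_cat -!stepE !step_restrict// stptN//.
  have -> : bor a b = bneg (band (bneg a) (bneg b)).
    by apply/funext => x; rewrite /bor /bneg /band -negb_or negbK.
  have BNb := balgN Bb.
  rewrite stptN ?stptI ?stptN//; last exact: balgI.
  rewrite -negb_or negbK; case: (boolP (p a)) => [pa _|pa /= pb].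
    by rewrite /= ?mulr0n ?mulr1n mulr1 mulr0 addr0; exact: hs.
  by rewrite /= ?mulr0n ?mulr1n mulr0 add0r mulr1; exact: ht.
pose F := [set V : set K | exists2 a, ok a & forall p : K, ~ p a -> V p].
have PF : ProperFilter F.
  apply: Build_ProperFilter_ex.
    move=> V [a [Ba [s sB hs]] aV]; apply: contrapT => h; apply: nex.
    by exists s => // p; apply: hs; apply: contrapT => npa; apply: h; exists p; exact: aV.
  split.
  - exists (bneg btop) => //; split; first exact: balg0.
    by exists [::] => // p; rewrite stpt0.
  - move=> V W [a oka aV] [b okb bW]; exists (bor a b); first exact: okU.
    have [[Ba _] [Bb _]] := (oka, okb).
    have Bab := balgU Ba Bb.
    have sub c : B c -> band c (bor a b) = c -> forall p : K, p c -> p (bor a b).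
      by move=> Bc E p; rewrite -E stptI// => /andP[].
    move=> p npab; split.
      apply: aV => pa; apply: npab; apply: (sub a Ba) pa.
      by apply/funext => x; rewrite /band /bor; case: (a x).
    apply: bW => pb; apply: npab; apply: (sub b Bb) pb.
    by apply/funext => x; rewrite /band /bor; case: (b x); rewrite ?orbT.
  - by move=> V W VW [a oka aV]; exists a => // p /aV/VW.
have [|p [_ clp]] := @stone_compact T B F PF; first exact: filterT.
have fc := proj2_sig f; have /cvgrPdist_le /(_ _ e0) := fc p.
rewrite nbhsE => -[V [oV Vp] VO]; have [a pa aV] := oV _ Vp.
have Ba := stpt_sub pa.
have Fa : F [set q : K | ~ q a].
  exists a => //; split => //; exists [:: (sval f p, a)].
    by move=> x; rewrite inE => /eqP ->.
  by move=> q qa; rewrite stepE big_seq1 /= qa mulr1 distrC; exact: VO (aV _ qa).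
have [q [/= nqa qa]] := clp _ _ Fa (open_nbhs_nbhs (conj (@open_clopen T B a) pa)).
exact: nqa.
Qed.

(** Positivity is applied to [M + f] and [M - f]. *)
Lemma PK_bound phi : PK R K phi ->
  forall f (M : R), (forall x, `|sval f x| <= M) -> `|phi f| <= M.
Proof.
move=> [[L _] [pos one]] f M fM.
have i1 : phi (ind btop) = 1.
  by apply: one => p /=; rewrite stptT.
have h (c : R) : `|c| = 1 -> 0 <= M + c * phi f.
  move=> c1.
  have <- : phi (linCK M c (ind btop) f) = M + c * phi f.
    by rewrite (L M c (ind btop) f)// i1 mulr1.
  apply: pos => x /=; rewrite stptT mulr1.
  have := fM x; rewrite -[`|_|]mul1r -c1 -normrM ler_norml => /andP[]; lra.
have := h 1 (normr1 _); have := h (-1) (normrN1 _); rewrite ler_norml => ? ?.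
by apply/andP; split; lra.
Qed.

Lemma PK_MK phi : PK R K phi -> MK R K phi.
Proof. by case. Qed.

Lemma PK_wstar (u : nat -> CK R K -> R) phi :
  (forall k, PK R K (u k)) -> wstar_cvg R K u phi -> PK R K phi.
Proof.
move=> uP uphi.
have L : lin_functional R K phi.
  move=> a b f g h hfg.
  have h1 : (fun n => u n h) @ \oo --> a * phi f + b * phi g.
    have -> : (fun n => u n h) = (fun n => a * u n f + b * u n g).
      by apply/funext => n; have [[Ln _] _] := uP n; exact: Ln.
    by apply: cvgD; apply: cvgM; [exact: cvg_cst|exact: uphi|exact: cvg_cst|exact: uphi].
  exact: (cvg_unique _ (uphi h) h1).
split; [split => //|split].
- exists 1 => f M fM; rewrite mul1r.
  have h1 : (fun n => `|u n f|) @ \oo --> `|phi f| by apply: cvg_norm; exact: uphi.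
  rewrite -(cvg_lim _ h1)//; apply: limr_le; first by apply/cvg_ex; exists `|phi f|.
  by near=> n; exact: (PK_bound (uP n)).
- move=> f f0; rewrite -(cvg_lim _ (uphi f))//; apply: limr_ge.
    by apply/cvg_ex; exists (phi f).
  by near=> n; have [_ [+ _]] := uP n; exact.
- move=> f f1; rewrite -(cvg_lim _ (uphi f))//.
  have -> : (fun n => u n f) = cst 1.
    by apply/funext => n; have [_ [_ +]] := uP n; exact.
  by rewrite lim_cst.
Unshelve. all: by end_near. Qed.

(** Probability functionals are contractions for the sup norm, so convergence on the uniformly dense
    step functions is enough. *)
Lemma wstar_of_ind (u : nat -> CK R K -> R) phi :
  (forall k, PK R K (u k)) -> PK R K phi ->
  (forall a, B a -> (fun k => u k (ind a)) @ \oo --> phi (ind a)) ->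
  wstar_cvg R K u phi.
Proof.
move=> uP phiP h f; apply: cvg_of_approx => e e0.
have [s sB fs] := approx_step f e0.
exists (fun k => u k (step s)), (phi (step s)).
have app psi : PK R K psi -> `|psi f - psi (step s)| <= e.
  move=> psiP; have [[L _] _] := psiP.
  have := PK_bound psiP (f := linCK 1 (-1) f (step s)).
  rewrite (L 1 (-1) f (step s))//= mul1r mulN1r; apply => x.
  by rewrite mul1r mulN1r; exact: fs.
split; [|by move=> k; exact: app|exact: app].
have [[L _] _] := phiP; rewrite (lin_step _ L).
have -> : (fun k => u k (step s)) = (fun k => \sum_(x <- s) x.1 * u k (ind x.2)).
  by apply/funext => k; have [[Lk _] _] := uP k; rewrite (lin_step _ Lk).
elim: s sB {fs app} => [_|x s IH sB].
  rewrite big_nil; have -> : (fun k => \sum_(x <- [::]) x.1 * u k (ind x.2)) = cst 0.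
    by apply/funext => k; rewrite big_nil.
  exact: cvg_cst.
rewrite big_cons.
have -> : (fun k => \sum_(y <- x :: s) y.1 * u k (ind y.2)) =
   (fun k => x.1 * u k (ind x.2) + \sum_(y <- s) y.1 * u k (ind y.2)).
  by apply/funext => k; rewrite big_cons.
apply: cvgD; last by apply: IH => y ys; apply: sB; rewrite inE ys orbT.
by apply: cvgM; [exact: cvg_cst|apply: h; apply: sB; exact: mem_head].
Qed.

Lemma wstar_ex (u : nat -> CK R K -> R) :
  (forall k, PK R K (u k)) ->
  (forall a, B a -> cvgn (fun k => u k (ind a))) ->
  exists2 phi, PK R K phi & wstar_cvg R K u phi.
Proof.
move=> uP h.
have w : wstar_cvg R K u (fun f => lim ((fun k => u k f) @ \oo)).
  move=> f; apply: is_cvg_of_approx => e e0.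
  have [s sB fs] := approx_step f e0.
  exists (fun k => u k (step s)); last first.
    move=> k; have [[L _] _] := uP k.
    have := PK_bound (uP k) (f := linCK 1 (-1) f (step s)).
    rewrite (L 1 (-1) f (step s))//= mul1r mulN1r; apply => x.
    by rewrite mul1r mulN1r; exact: fs.
  have -> : (fun k => u k (step s)) = (fun k => \sum_(x <- s) x.1 * u k (ind x.2)).
    by apply/funext => k; have [[Lk _] _] := uP k; rewrite (lin_step _ Lk).
  elim: s sB {fs} => [_|x s IH sB].
    have -> : (fun k => \sum_(x <- [::]) x.1 * u k (ind x.2)) = cst 0.
      by apply/funext => k; rewrite big_nil.
    exact: is_cvg_cst.
  have -> : (fun k => \sum_(y <- x :: s) y.1 * u k (ind y.2)) =
     (fun k => x.1 * u k (ind x.2) + \sum_(y <- s) y.1 * u k (ind y.2)).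
    by apply/funext => k; rewrite big_cons.
  apply: is_cvgD; last by apply: IH => y ys; apply: sB; rewrite inE ys orbT.
  by apply: is_cvgM; [exact: is_cvg_cst|apply: h; apply: sB; exact: mem_head].
by exists (fun f => lim ((fun k => u k f) @ \oo)) => //; exact: PK_wstar w.
Qed.

(** Probability measures on the Stone space are determined by their values on clopen sets, so from
    here on measures are handled as nonnegative finitely additive functions on [B]. *)
Definition fadd m :=
  (forall a, B a -> 0 <= m a) /\
  (forall a b, B a -> B b -> m (band a b) + m (band a (bneg b)) = m a).

Lemma PK_fadd phi : PK R K phi -> fadd (fun a => phi (ind a)).
Proof.
move=> [[L _] [pos _]]; split => [a Ba|a b Ba Bb].
  by apply: pos => p /=; rewrite ler0n.
rewrite (L 1 1 (ind (band a b)) (ind (band a (bneg b))) (ind a)) ?mul1r//.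
move=> p /=; rewrite !stptI ?stptN//; last exact: balgN.
by case: (p a); case: (p b); rewrite /= !mul1r ?addr0 ?add0r.
Qed.

Definition fincomb (s : seq (R * stone B)) a : R :=
  \sum_(x <- s) x.1 * (x.2 a)%:R.

Definition nonneg_weights (s : seq (R * stone B)) := all (fun x => 0 <= x.1) s.

(* The traces on [B] of the nonnegative multiples of [Seq(co Delta)]; leaving
   out the normalization makes them a cone. *)
Inductive good : ((T -> bool) -> R) -> Prop :=
| good_fin s : nonneg_weights s -> good (fincomb s)
| good_lim u m : (forall k, good (u k)) ->
    (forall a, B a -> (fun k : nat => u k a) @ \oo --> m a) -> good m.

Lemma coDeltaP phi : coDelta R K phi <->
  exists s, [/\ nonneg_weights s, \sum_(x <- s) x.1 = 1 &
    phi = (fun f => \sum_(x <- s) x.1 * sval f x.2)].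
Proof.
split => [[n [t [a [a0 [a1 ->]]]]]|[s [s0 s1 ->]]].
  exists [seq (a i, t i) | i <- enum 'I_n]; split.
  - by apply/allP => x /mapP[i _ ->]; exact: a0.
  - by rewrite big_map big_enum.
  - by apply/funext => f; rewrite big_map big_enum.
exists (size s), (fun i => (tnth (in_tuple s) i).2), (fun i => (tnth (in_tuple s) i).1).
split; [|split].
- by move=> i; move/allP : s0; apply; exact: mem_tnth.
- by rewrite -s1 [in RHS]big_tnth.
- by apply/funext => f; rewrite [in LHS]big_tnth.
Qed.

Lemma coDelta_PK phi : coDelta R K phi -> PK R K phi.
Proof.
move=> /coDeltaP[s [s0 s1 ->]].
have L : lin_functional R K (fun f => \sum_(x <- s) x.1 * sval f x.2).
  move=> a b f g h hfg; rewrite !mulr_sumr -big_split/=; apply: eq_bigr => x _.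
  by rewrite hfg; ring.
split; [split => //|split].
- exists 1 => f M fM; rewrite mul1r.
  apply: (le_trans (ler_norm_sum _ _ _)).
  rewrite -[M]mul1r -s1 mulr_suml big_seq [leRHS]big_seq.
  apply: ler_sum => x xs; rewrite normrM.
  have x0 : 0 <= x.1 by move/allP : s0; apply.
  by rewrite ger0_norm// ler_wpM2l.
- move=> f f0; rewrite big_seq; apply: sumr_ge0 => x xs; apply: mulr_ge0 => //.
  by move/allP : s0; apply.
- by move=> f f1; rewrite -s1; apply: eq_bigr => x _; rewrite f1 mulr1.
Qed.

Lemma PK_seq_closed : seq_closed R K (PK R K).
Proof. by split => [phi []//|phi [_ [u [uP /(PK_wstar uP)]]]]. Qed.

Lemma SeqCl_PK : SeqCl R K (coDelta R K) `<=` PK R K.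
Proof. by move=> phi; apply; [exact: PK_seq_closed|exact: coDelta_PK]. Qed.

Lemma SeqCl_lim (u : nat -> CK R K -> R) phi :
  (forall k, SeqCl R K (coDelta R K) (u k)) -> wstar_cvg R K u phi ->
  SeqCl R K (coDelta R K) phi.
Proof.
move=> uS w D Dcl AD; have [_ h] := Dcl; apply: h; split.
  by apply: PK_MK; apply: PK_wstar w => k; exact: SeqCl_PK.
by exists u; split => // k; exact: uS.
Qed.

(** Total masses converge to a positive number along a limit, so a tail of the sequence can be
    normalized, and [wstar_ex] supplies the limit functional. *)
Lemma good_SeqCl m : good m -> 0 < m btop ->
  exists2 phi, SeqCl R K (coDelta R K) phi &
    forall a, B a -> phi (ind a) = m a / m btop.
Proof.
elim=> {m} [s s0|u m ug IH um] m0.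
  exists (fun f => \sum_(x <- s) (x.1 / fincomb s btop) * sval f x.2); last first.
    move=> a Ba; rewrite [in RHS]/fincomb mulr_suml; apply: eq_bigr => x _.
    by rewrite /=; ring.
  move=> D _; apply.
  apply/coDeltaP; exists [seq (x.1 / fincomb s btop, x.2) | x <- s]; split.
  - apply/allP => _ /mapP[x xs ->] /=; apply: divr_ge0; last exact: ltW.
    by move/allP : s0; apply.
  - have E : fincomb s btop = \sum_(x <- s) x.1.
      by apply: eq_bigr => x _; rewrite stptT mulr1.
    by rewrite big_map /= -mulr_suml -E divff// gt_eqF.
  - by apply/funext => f; rewrite big_map.
have BT := balgT B.
have /cvgrPdist_lt /(_ _ m0) [N _ hN] := um _ BT.
have u0 k : 0 < u (k + N)%N btop.
  have /hN : (N <= k + N)%N by rewrite leq_addl.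
  by rewrite /= ltr_norml => /andP[_]; lra.
have hex k : exists phi, SeqCl R K (coDelta R K) phi /\
    forall a, B a -> phi (ind a) = u (k + N)%N a / u (k + N)%N btop.
  by have [phi ? ?] := IH (k + N)%N (u0 k); exists phi.
have [v hv] := choice hex.
have vcv a : B a -> (fun k => v k (ind a)) @ \oo --> m a / m btop.
  move=> Ba.
  have -> : (fun k => v k (ind a)) = (fun k => u (k + N)%N a / u (k + N)%N btop).
    by apply/funext => k; have [_ ->] := hv k.
  apply: cvgM; first by rewrite (cvg_shiftn N (u^~ _)); exact: um.
  apply: cvgV; first by rewrite gt_eqF.
  by rewrite (cvg_shiftn N (u^~ _)); exact: um.
have vP k : PK R K (v k) by apply: SeqCl_PK; have [] := hv k.
have [a Ba|phi phiP w] := wstar_ex vP.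
  by apply/cvg_ex; exists (m a / m btop); exact: vcv.
exists phi; first by apply: SeqCl_lim w => k; have [] := hv k.
by move=> a Ba; apply: cvg_unique (w (ind a)) (vcv a Ba).
Qed.

Lemma ind_determines phi psi : PK R K phi -> PK R K psi ->
  (forall a, B a -> phi (ind a) = psi (ind a)) -> phi = psi.
Proof.
move=> phiP psiP h.
have w : wstar_cvg R K (fun=> phi) psi.
  by apply: wstar_of_ind => // a Ba; rewrite h//; exact: cvg_cst.
apply/funext => f; apply: (cvg_unique _ _ (w f)) => //; exact: cvg_cst.
Qed.

(** This reduces the theorem to measures on [B]: if all of them are good, the sequential closure is
    all of [PK]; and then [mu] lies in the closure without being the limit of a sequence of finitely
    supported measures. *)
Lemma stone_reduction mu :
  (forall m, fadd m -> good m) ->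
  fadd mu -> mu btop = 1 ->
  (forall s : nat -> seq (R * stone B), (forall k, nonneg_weights (s k)) ->
     ~ (forall a, B a -> (fun k => fincomb (s k) a) @ \oo --> mu a)) ->
  Seq1 R K (coDelta R K) <> SeqCl R K (coDelta R K) /\
  SeqCl R K (coDelta R K) = PK R K.
Proof.
move=> allgood fmu mu1 nomu; split; last first.
  apply/seteqP; split; first exact: SeqCl_PK.
  move=> phi phiP.
  have phi1 : phi (ind btop) = 1.
    by have [_ [_ ->]] := phiP => // p /=; rewrite stptT.
  have [|psi psiS h] := good_SeqCl (allgood _ (PK_fadd phiP)); first by rewrite phi1.
  rewrite (ind_determines phiP (SeqCl_PK psiS))// => a Ba.
  by rewrite h// phi1 divr1.
have [|psi psiS h] := good_SeqCl (allgood _ fmu); first by rewrite mu1.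
move=> E; move: (psiS); rewrite -E => -[_ [u [uD w]]].
have hex k : exists s, [/\ nonneg_weights s, \sum_(x <- s) x.1 = 1 &
    u k = (fun f => \sum_(x <- s) x.1 * sval f x.2)] by apply/coDeltaP/uD.
have [s hs] := choice hex.
apply: (nomu s) => [k|a Ba]; first by have [] := hs k.
have := w (ind a); rewrite h// mu1 divr1.
by have -> : (fun k => u k (ind a)) = (fun k => fincomb (s k) a)
  by apply/funext => k; have [_ _ ->] := hs k.
Qed.

End Functionals.

Ltac btaut :=
  let x := fresh "x" in
  apply/funext => x; rewrite /band /bor /bneg /bxor /btop /=;
  repeat match goal with |- context [?f x] => case: (f x) end; by [].

(** * Calculus of finitely additive measures and stability of the good ones *)

Section FinitelyAdditive.
Variables (R : realType) (T : Type) (B : boolalg T).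
Implicit Types (a b c : T -> bool) (m : (T -> bool) -> R).

Definition bsub a b := forall x, a x -> b x.

Lemma bsubE a b : bsub a b -> band b a = a.
Proof.
by move=> ab; apply/funext => x; rewrite /band andbC; case: (boolP (a x)) => // /ab.
Qed.

Lemma fadd_split m : fadd B m -> forall a b, B a -> B b ->
  m a = m (band a b) + m (band a (bneg b)).
Proof. by move=> [_ h] a b Ba Bb; rewrite h. Qed.

Lemma fadd_le m : fadd B m -> forall a b, B a -> B b -> bsub a b -> m a <= m b.
Proof.
move=> [h0 h] a b Ba Bb ab; rewrite -(h b a)// bsubE// lerDl.
by apply: h0; apply: balgI => //; exact: balgN.
Qed.

Lemma fadd0 m : fadd B m -> m (bneg btop) = 0.
Proof.
move=> [_ h]; have := h btop btop (balgT B) (balgT B).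
have -> : band (btop : T -> bool) btop = btop by btaut.
have -> : band (btop : T -> bool) (bneg btop) = bneg btop by btaut.
by move=> h0; lra.
Qed.

Lemma fadd_leU m : fadd B m -> forall a b, B a -> B b -> m (bor a b) <= m a + m b.
Proof.
move=> fm a b Ba Bb; rewrite (fadd_split fm (balgU Ba Bb) Ba).
have -> : band (bor a b) a = a by btaut.
rewrite lerD2l; have BN := balgN Ba; apply: fadd_le => //.
  by apply: balgI => //; exact: balgU.
by move=> x; rewrite /band /bor /bneg; case: (a x); case: (b x).
Qed.

Lemma fadd_eq0 m a b : fadd B m -> B a -> B b -> bsub a b -> m b = 0 -> m a = 0.
Proof.
move=> fm Ba Bb ab mb; apply/eqP; rewrite eq_le; apply/andP; split.
  by rewrite -mb; exact: fadd_le.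
by case: fm => + _; apply.
Qed.

Lemma fadd_restrict m c : fadd B m -> B c -> fadd B (fun a => m (band a c)).
Proof.
move=> fm Bc; split => [a Ba|a b Ba Bb]; first by apply: fm.1; exact: balgI.
have BN := balgN Bb.
rewrite (fadd_split fm (balgI Ba Bc) Bb); congr (m _ + m _); btaut.
Qed.

Lemma fadd_lim (u : nat -> (T -> bool) -> R) m : (forall k, fadd B (u k)) ->
  (forall a, B a -> u^~ a @ \oo --> m a) -> fadd B m.
Proof.
move=> fu um; split => [a Ba|a b Ba Bb].
  rewrite -(cvg_lim _ (um a Ba))//; apply: limr_ge.
    by apply/cvg_ex; exists (m a); exact: um.
  by near=> k; have [+ _] := fu k; exact.
have BN := balgN Bb.
have h : (fun k => u k (band a b) + u k (band a (bneg b))) @ \oo -->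
    m (band a b) + m (band a (bneg b)).
  by apply: cvgD; apply: um; exact: balgI.
have E : (fun k => u k (band a b) + u k (band a (bneg b))) = u^~ a.
  by apply/funext => k /=; have [_ ->] := fu k.
by rewrite E in h; exact: (cvg_unique _ h (um a Ba)).
Unshelve. all: by end_near. Qed.

Lemma fincomb_fadd s : nonneg_weights s -> fadd B (@fincomb R T B s).
Proof.
move=> s0; split => [a Ba|a b Ba Bb].
  rewrite /fincomb big_seq; apply: sumr_ge0 => x xs; apply: mulr_ge0; rewrite ?ler0n//.
  by move/allP : s0; apply.
rewrite /fincomb -big_split/=; apply: eq_bigr => x _; rewrite -mulrDr -natrD.
congr (_ * _%:R); have BN := balgN Bb.
by rewrite !stptI// stptN//; case: (x.2 a); case: (x.2 b).
Qed.

(** [good_lim] looks only at values on [B], so a constant sequence can have a limit with other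
    values outside [B]. *)
Lemma good_ext m m' : good B m -> (forall a, B a -> m a = m' a) -> good B m'.
Proof.
move=> gm h; apply: (good_lim (u := fun=> m)) => // a Ba; rewrite h//; exact: cvg_cst.
Qed.

(** Induction on both derivations: limits are taken in one summand while the other is fixed. *)
Lemma goodD m m' : good B m -> good B m' -> good B (fun a => m a + m' a).
Proof.
move=> gm; elim: gm m' => {m} [s s0|u m ug IH um] m' gm'; last first.
  apply: (good_lim (u := fun k a => u k a + m' a)) => [k|a Ba]; first exact: IH.
  by apply: cvgD; [exact: um|exact: cvg_cst].
elim: gm' => {m'} [t t0|u m ug IH um].
  have -> : (fun a => fincomb s a + fincomb t a) = fincomb (s ++ t).
    by apply/funext => a; rewrite /fincomb big_cat.
  by apply: good_fin; rewrite /nonneg_weights all_cat; apply/andP.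
apply: (good_lim (u := fun k a => fincomb s a + u k a)) => [k|a Ba]; first exact: IH.
by apply: cvgD; [exact: cvg_cst|exact: um].
Qed.

Lemma goodZ (r : R) m : 0 <= r -> good B m -> good B (fun a => r * m a).
Proof.
move=> r0; elim=> {m} [s s0|u m ug IH um].
  have -> : (fun a => r * fincomb s a) = fincomb [seq (r * x.1, x.2) | x <- s].
    apply/funext => a; rewrite /fincomb big_map mulr_sumr.
    by apply: eq_bigr => x _; rewrite mulrA.
  apply: good_fin; apply/allP => _ /mapP[x xs ->] /=; apply: mulr_ge0 => //.
  by move/allP : s0; apply.
apply: (good_lim (u := fun k a => r * u k a)) => // a Ba.
by apply: cvgM; [exact: cvg_cst|exact: um].
Qed.

Lemma good0 : good B (fun=> 0 : R).
Proof.
apply: (good_ext (@good_fin R T B [::] _)) => // a _.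
by rewrite /fincomb big_nil.
Qed.

Lemma good_sum (I : Type) (r : seq I) (F : I -> (T -> bool) -> R) :
  (forall i, good B (F i)) -> good B (fun a => \sum_(i <- r) F i a).
Proof.
move=> h; elim: r => [|i r IH].
  by apply: (good_ext good0) => a _; rewrite big_nil.
by apply: (good_ext (goodD (h i) IH)) => a _; rewrite big_cons.
Qed.

(** The measure is split along the members of [l] one after another, [c] being the atom that carries
    the current piece. At the end the mass of each piece is put at one principal point of its
    atom. *)
Lemma fincomb_matching (l : seq (T -> bool)) c m : fadd B m -> B c ->
  m (bneg c) = 0 -> (forall a, a \in l -> B a) ->
  exists s : seq (R * stone B), [/\ nonneg_weights s, fincomb s (bneg c) = 0,
    fincomb s btop = m btop & forall a, a \in l -> fincomb s a = m a].
Proof.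
elim: l c m => [|d l IH] c m fm Bc mc lB.
  have [m0|m0] := eqVneq (m btop) 0.
    by exists [::]; split => //; rewrite /fincomb big_nil.
  have [x cx] : exists x, c x.
    apply: contrapT => h; move/eqP: m0; apply; rewrite -mc; congr m.
    by apply/funext => x; rewrite /bneg; case: (boolP (c x)) => // cx; case: h; exists x.
  exists [:: (m btop, evpt B x)]; split => //.
  - by rewrite /nonneg_weights /= andbT; apply: fm.1; exact: balgT.
  - by rewrite /fincomb big_seq1 evptE ?/bneg ?cx ?mulr0//; exact: balgN.
  - by rewrite /fincomb big_seq1 stptT mulr1.
have Bd : B d by apply: lB; exact: mem_head.
have lB' a : a \in l -> B a by move=> al; apply: lB; rewrite inE al orbT.
have BNd := balgN Bd; have BNc := balgN Bc.
have f1 := fadd_restrict fm Bd; have f2 := fadd_restrict fm BNd.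
have part e : B e -> m (band (bneg (band c e)) e) = 0.
  move=> Be; apply: (fadd_eq0 fm _ BNc _ mc).
    by apply: balgI => //; apply: balgN; exact: balgI.
  by move=> x; rewrite /band /bneg; case: (c x); case: (e x).
have [s1 [p1 c1 t1 h1]] := IH _ _ f1 (balgI Bc Bd) (part _ Bd) lB'.
have [s2 [p2 c2 t2 h2]] := IH _ _ f2 (balgI Bc BNd) (part _ BNd) lB'.
have F1 := fincomb_fadd p1; have F2 := fincomb_fadd p2.
have catE a : fincomb (s1 ++ s2) a = fincomb s1 a + fincomb s2 a.
  by rewrite /fincomb big_cat.
have B1 := balgN (balgI Bc Bd); have B2 := balgN (balgI Bc BNd).
exists (s1 ++ s2); split.
- by rewrite /nonneg_weights all_cat; apply/andP.
- rewrite catE (fadd_eq0 F1 BNc B1 _ c1) ?(fadd_eq0 F2 BNc B2 _ c2) ?addr0// => x.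
    by rewrite /band /bneg; case: (c x).
  by rewrite /band /bneg; case: (c x).
- by rewrite catE t1 t2 -(fadd_split fm (balgT B) Bd).
- move=> a; rewrite inE catE => /orP[/eqP -> {a}|al]; last first.
    by rewrite h1// h2// -(fadd_split fm (lB' _ al) Bd).
  have -> : fincomb s2 d = 0.
    by apply: (fadd_eq0 F2 Bd B2 _ c2) => x; rewrite /band /bneg; case: (c x); case: (d x).
  have -> : fincomb s1 d = fincomb s1 btop.
    rewrite [RHS](fadd_split F1 (balgT B) Bd).
    rewrite (fadd_eq0 F1 (balgI (balgT B) BNd) B1 _ c1) ?addr0.
      by congr fincomb; btaut.
    by move=> x; rewrite /band /bneg; case: (c x); case: (d x).
  by rewrite t1 addr0; congr m; btaut.
Qed.

(** The closed set given by all the [E k] carries [m], and only countably many traces of [B] exist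
    on it, so it is metrizable. Finite combinations that match [m] on more and more of these traces
    converge, each value being eventually constant. *)
Lemma good_tower m (E S : nat -> T -> bool) : fadd B m ->
  (forall k, B (E k)) -> (forall j, B (S j)) -> (forall k, m (bneg (E k)) = 0) ->
  (forall a, B a -> exists k j, band a (E k) = band (S j) (E k)) -> good B m.
Proof.
move=> fm BE BS mE tr.
(* The complements of the [E k] are matched too: this forces the approximants to vanish off
   [E k]. *)
pose l n := [seq band (S j) (E k) | j <- iota 0 n, k <- iota 0 n] ++
            [seq bneg (E k) | k <- iota 0 n].
have lB n a : a \in l n -> B a.
  rewrite mem_cat => /orP[/allpairsP[[j k] [_ _ ->]]|/mapP[k _ ->]] /=.
    exact: balgI.
  exact: balgN.
have m0 : m (bneg btop) = 0 by exact: fadd0.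
have hex n : exists s : seq (R * stone B), nonneg_weights s /\
    forall a, a \in l n -> fincomb s a = m a.
  by have [s [? _ _ ?]] := fincomb_matching fm (balgT B) m0 (@lB n); exists s.
have [s hs] := choice hex.
apply: (good_lim (u := fun n => fincomb (s n))) => [n|a Ba].
  by apply: good_fin; have [] := hs n.
have [k [j akj]] := tr a Ba.
apply: cvg_near_cst; exists (maxn k j).+1 => // n /=; rewrite gtn_max => /andP[kn jn].
have [s0 h] := hs n; have F := fincomb_fadd s0; have BN := balgN (BE k).
have z (f : (T -> bool) -> R) : fadd B f -> f (bneg (E k)) = 0 ->
    f a = f (band (S j) (E k)).
  move=> ff f0; rewrite (fadd_split ff Ba (BE k)) akj.
  rewrite (fadd_eq0 ff (balgI Ba BN) BN _ f0) ?addr0// => x.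
  by rewrite /band => /andP[].
rewrite (z m fm (mE k)) (z _ F); last first.
  by rewrite h ?mE// mem_cat; apply/orP; right; apply: map_f; rewrite mem_iota.
apply: h; rewrite mem_cat; apply/orP; left; apply/allpairsP; exists (j, k).
by rewrite !mem_iota.
Qed.

End FinitelyAdditive.

(** * Powers of one half as rates of convergence *)

Section Geometric.
Variable R : realType.

Definition half_pow (i : nat) : R := 2^-1 ^+ i.

Lemma half_pow_gt0 i : 0 < half_pow i.
Proof. by rewrite exprn_gt0// invr_gt0. Qed.

Lemma half_powS i : half_pow i = half_pow i.+1 + half_pow i.+1.
Proof. by rewrite /half_pow exprS; field. Qed.

Lemma half_pow_le i j : (i <= j)%N -> half_pow j <= half_pow i.
Proof. by move=> ij; apply: ler_wiXn2l => //; rewrite ?invr_ge0 ?invf_le1//; lra. Qed.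

Lemma half_pow_small (e : R) : 0 < e -> exists N, forall n, (N <= n)%N -> half_pow n <= e.
Proof.
move=> e0; have : half_pow @ \oo --> (0 : R).
  by apply: cvg_expr; rewrite ger0_norm ?invr_ge0// invf_lt1//; lra.
move=> /cvgrPdist_le /(_ _ e0) [N _ h]; exists N => n /h /=.
by rewrite sub0r normrN ger0_norm// ltW// half_pow_gt0.
Qed.

Lemma geometric_cvg (u : nat -> R) :
  (forall i j, (i <= j)%N -> `|u i - u j| <= half_pow i) -> cvgn u.
Proof.
move=> h; apply: is_cvg_of_approx => e /half_pow_small[N hN].
exists (fun k => if (k < N)%N then u k else u N).
  apply/cvg_ex; exists (u N); apply: cvg_near_cst; exists N => // k /= Nk.
  by rewrite ltnNge Nk.
move=> k; case: ltnP => [_|Nk]; rewrite ?subrr ?normr0.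
  by apply: le_trans (hN N _); rewrite ?ltW ?half_pow_gt0.
by rewrite distrC; apply: le_trans (h _ _ Nk) _; exact: hN.
Qed.

Lemma cvg_near0 (u : nat -> R) (C : R) (l : R) :
  (forall i, `|u i - l| <= C * half_pow i) -> u @ \oo --> l.
Proof.
move=> hu; apply/cvgrPdist_le => e e0.
have C1 : 0 < `|C| + 1 by rewrite ltr_wpDl.
have [N hN] := half_pow_small (divr_gt0 e0 C1).
exists N => // i /= Ni; rewrite distrC; apply: le_trans (hu i) _.
have := hN i Ni; rewrite ler_pdivlMr// => hi; apply: le_trans hi.
rewrite mulrC ler_wpM2l ?ltW ?half_pow_gt0//.
by apply: le_lt_trans (ler_norm C) _; rewrite ltrDl.
Qed.

End Geometric.

(** * Lebesgue decomposition *)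

Section Decomposition.
Variables (R : realType) (T : Type) (B : boolalg T) (mu : (T -> bool) -> R).
Implicit Types (a b c : T -> bool) (m : (T -> bool) -> R).
Hypothesis fmu : fadd B mu.

Definition abs_cont m := forall e : R, 0 < e -> exists2 d : R, 0 < d &
  forall a, B a -> mu a <= d -> m a <= e.

(** Here [m] is carried by a closed [mu]-null set, presented as a decreasing intersection of clopen
    sets. *)
Hypothesis good_singular : forall m (E : nat -> T -> bool), fadd B m ->
  (forall k, B (E k)) -> (forall k, bsub (E k.+1) (E k)) ->
  mu \o E @ \oo --> (0 : R) -> (forall k, m (bneg (E k)) = 0) -> good B m.
Hypothesis good_abs_cont : forall m, fadd B m -> abs_cont m -> good B m.

Notation h := (half_pow R).

(** The constant [c] is the mass of the [mu]-singular part of [m]: the limit, as the allowed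
    [mu]-measure shrinks to 0, of the supremum of [m]. *)
Lemma essential_sup m : fadd B m -> exists c : R,
  (forall d e : R, 0 < d -> 0 < e -> exists a, [/\ B a, mu a <= d & c - e < m a]) /\
  (forall e : R, 0 < e -> exists n, forall a, B a -> mu a <= h n -> m a < c + e).
Proof.
move=> fm.
pose V n := [set m a | a in [set a | B a /\ mu a <= h n]].
have V0 n : V n !=set0.
  exists (m (bneg btop)); exists (bneg btop) => //; split; first exact: balg0.
  by rewrite (fadd0 fmu) ltW// half_pow_gt0.
have Vub n : has_sup (V n).
  by split => //; exists (m btop) => _ [a [Ba _] <-]; apply: (fadd_le fm Ba (balgT B)).
pose W := range (fun n => sup (V n)).
have Winf : has_inf W.
  split; first by exists (sup (V 0%N)), 0%N.
  exists 0 => _ [n _ <-]; have [x Vx] := V0 n.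
  apply: le_trans (ub_le_sup (Vub n).2 Vx); case: Vx => a [Ba _] <-.
  by case: fm => + _; apply.
exists (inf W); split.
- move=> d e d0 e0; have [N hN] := half_pow_small d0.
  have : inf W - e < sup (V N).
    apply: lt_le_trans (ge_inf Winf.2 _); last by exists N.
    by rewrite ltrBlDr ltrDl.
  move=> /(sup_gt (V0 N)) [_ [a [Ba ma] <-] ?]; exists a; split => //.
  by apply: le_trans ma _; exact: hN.
- move=> e e0; have : inf W < inf W + e by rewrite ltrDl.
  move=> /(inf_lt Winf.1) [_ [n _ <-] hn]; exists n => a Ba ma.
  by apply: le_lt_trans hn; apply: (ub_le_sup (Vub n).2); exists a.
Qed.

(* The sets [X i] nearly realize the essential supremum of [m] on small sets,
   so that they are [m]-Cauchy while their [mu]-measure tends to [0]. *)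
Lemma cauchy_sets m : fadd B m -> exists X : nat -> T -> bool,
  [/\ forall i, B (X i), forall i, mu (X i) <= h i,
    forall i j, (i <= j)%N -> m (band (X i) (bneg (X j))) <= h i,
    forall i j, (i <= j)%N -> m (band (X j) (bneg (X i))) <= h i &
    forall e : R, 0 < e -> exists n, exists N, forall a i, (N <= i)%N -> B a ->
      mu a <= h n -> m (band a (bneg (X i))) <= e].
Proof.
move=> fm; have [c [F1 F2]] := essential_sup fm.
have [n hn] := choice (fun i => F2 (h i.+1) (half_pow_gt0 R i.+1)).
(* [N i] bounds [i] and all thresholds [n k] with [k <= i], so [X j] is small enough for every
   earlier threshold. *)
pose N i := (i + \sum_(k < i.+1) n k)%N.
have nN i j : (i <= j)%N -> (n i <= N j)%N.
  move=> ij; rewrite /N (bigD1 (Ordinal (n := j.+1) (m := i) ij))//=.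
  by rewrite addnCA leq_addr.
have iN i j : (i <= j)%N -> (i <= N j)%N.
  by move=> ij; apply: leq_trans ij _; exact: leq_addr.
have hex i : exists a, [/\ B a, mu a <= h (N i).+1 & c - h i.+1 < m a].
  by apply: F1; exact: half_pow_gt0.
have [X hX] := choice hex.
have BX i : B (X i) by have [] := hX i.
have Xm i : c - h i.+1 < m (X i) by have [] := hX i.
have Xmu i j : (i <= j)%N -> mu (X j) <= h i.+1.
  move=> ij; have [_ + _] := hX j; move=> /le_trans; apply.
  by apply: half_pow_le; exact: iN.
have Xn i j : (i <= j)%N -> mu (X j) <= h (n i).+1.
  move=> ij; have [_ + _] := hX j; move=> /le_trans; apply.
  by apply: half_pow_le; exact: nN.
(* The union of [a] and [X j] is still small enough to have [m]-measure below [c + h i.+1], while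
   [X j] alone already has more than [c - h j.+1]. *)
have diff a i j : (i <= j)%N -> B a -> mu a <= h (n i).+1 ->
    m (band a (bneg (X j))) <= h i.+1 + h j.+1.
  move=> ij Ba mua; have BU := balgU Ba (BX j).
  have BN := balgN (BX j).
  have : m (bor a (X j)) < c + h i.+1.
    apply: hn => //; apply: le_trans (fadd_leU fmu Ba (BX j)) _.
    by rewrite [leRHS]half_powS; apply: lerD => //; exact: Xn.
  rewrite (fadd_split fm BU (BX j)).
  have -> : band (bor a (X j)) (X j) = X j by btaut.
  have -> : band (bor a (X j)) (bneg (X j)) = band a (bneg (X j)) by btaut.
  have := Xm j; lra.
have hh i j : (i <= j)%N -> h i.+1 + h j.+1 <= h i.
  by move=> ij; rewrite [leRHS]half_powS lerD2l half_pow_le.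
exists X; split => //.
- move=> i; apply: le_trans (Xmu i i _) _ => //; exact: half_pow_le.
- move=> i j ij; apply: le_trans (diff _ i j ij (BX i) (Xn i i _)) _ => //; exact: hh.
- move=> i j ij; apply: le_trans (diff _ i i _ (BX j) (Xn i j ij)) _ => //.
  by rewrite -half_powS.
- move=> e e0; have [i0 hi] := half_pow_small e0.
  exists (n i0).+1, i0 => a i i0i Ba mua.
  apply: le_trans (diff _ i0 i i0i Ba mua) _.
  apply: le_trans (hh _ _ i0i) _; exact: hi.
Qed.

(** The restrictions of [m] to the sets [X i] converge to the singular part [psi], and the remainder
    is absolutely continuous. To see that [psi] is good, it is written as the limit of restrictions
    of [m] to closed null sets, the intersections of the tails of [X]. *)
Lemma good_all m : fadd B m -> good B m.
Proof.
move=> fm; have [X [BX muX X1 X2 X3]] := cauchy_sets fm.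
have BNX i := balgN (BX i).
pose u a i := m (band a (X i)).
have uC a i j : B a -> (i <= j)%N -> `|u a i - u a j| <= h i.
  move=> Ba ij; rewrite /u.
  rewrite (fadd_split fm (balgI Ba (BX i)) (BX j)).
  rewrite [X in _ - X](fadd_split fm (balgI Ba (BX j)) (BX i)).
  have -> : band (band a (X i)) (X j) = band (band a (X j)) (X i) by btaut.
  set z := m _; set p := m _; set q := m _.
  have ph : p <= h i.
    apply: le_trans (X1 i j ij); apply: (fadd_le fm) => //; do ?exact: balgI.
      by apply: balgI => //; exact: balgI.
    by move=> x; rewrite /band => /andP[/andP[_ ->] ->].
  have qh : q <= h i.
    apply: le_trans (X2 i j ij); apply: (fadd_le fm) => //; do ?exact: balgI.
      by apply: balgI => //; exact: balgI.
    by move=> x; rewrite /band => /andP[/andP[_ ->] ->].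
  have p0 : 0 <= p by apply: fm.1; apply: balgI => //; exact: balgI.
  have q0 : 0 <= q by apply: fm.1; apply: balgI => //; exact: balgI.
  by rewrite ler_norml; apply/andP; split; lra.
pose psi a := lim (u a @ \oo).
have ucv a : B a -> u a @ \oo --> psi a.
  by move=> Ba; apply: geometric_cvg => i j; exact: uC.
have psiu a i : B a -> `|u a i - psi a| <= h i.
  move=> Ba.
  have hcv : (fun j => `|u a i - u a j|) @ \oo --> `|u a i - psi a|.
    by apply: cvg_norm; apply: cvgB; [exact: cvg_cst|exact: ucv].
  rewrite -(cvg_lim _ hcv)//; apply: limr_le.
    by apply/cvg_ex; exists `|u a i - psi a|.
  by exists i => // j /= ij; exact: uC.
have fu i : fadd B (u^~ i) by exact: fadd_restrict.
have fpsi : fadd B psi by exact: fadd_lim fu ucv.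
have gpsi : good B psi.
  (* The intersection of [X i] up to [X (i + k)]: it decreases in [k] and its [mu]-measure tends to
     0, as [good_singular] demands. *)
  pose E i k := iteri k (fun j e => band e (X (i + j.+1)%N)) (X i).
  have BE i k : B (E i k) by elim: k => //= k IH; exact: balgI.
  have Esub i k : bsub (E i k.+1) (E i k) by move=> x /andP[].
  have Emon i k l : (k <= l)%N -> bsub (E i l) (E i k).
    by move=> /subnK <-; elim: (l - k)%N => [//|j IH] x /Esub/IH.
  have EX i k : bsub (E i k) (X (i + k)%N).
    by case: k => [|k]; rewrite ?addn0// => x /andP[].
  (* The bound is the sum of [h (i + j)] over [j < k], where [h (i + j)] bounds the mass lost from
     [X (i + j)] to the next set. *)
  have Em i k : m (band (X i) (bneg (E i k))) <= 2 * h i - 2 * h (i + k)%N.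
    elim: k => [|k IH].
      have -> : band (X i) (bneg (E i 0%N)) = bneg btop by rewrite /E/=; btaut.
      by rewrite (fadd0 fm) addn0 subrr.
    have BNk := balgN (BE i k).
    have B1 := balgI (BX i) BNk.
    have B2 := balgI (BX (i + k)%N) (BNX (i + k.+1)%N).
    have B3 := balgI (BX i) (balgN (BE i k.+1)).
    apply: le_trans (_ : _ <= m (band (X i) (bneg (E i k))) +
      m (band (X (i + k)%N) (bneg (X (i + k.+1)%N)))) _.
      apply: le_trans (fadd_leU fm B1 B2); apply: (fadd_le fm) => //; first exact: balgU.
      move=> x; have := @EX i k x; rewrite /band /bor /bneg /= /band.
      by case: (X i x); case: (E i k x); case: (X (i + k.+1)%N x) => //= ->.
    have := X1 (i + k)%N (i + k.+1)%N; rewrite leq_add2l leqnSn => /(_ isT).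
    have := half_powS R (i + k); rewrite -addnS; lra.
  have mono i a : B a -> {homo (fun k => m (band a (E i k))) : n p / (n <= p)%N >-> n >= p}.
    move=> Ba k l kl; apply: (fadd_le fm) => //; do ?exact: balgI.
    by move=> x /andP[ax /(Emon i k l kl) ex]; rewrite /band ax.
  (* The restriction of [m] to the closed set that is the intersection of all [E i k]. *)
  pose psii i a := lim ((fun k => m (band a (E i k))) @ \oo).
  have psicv i a : B a -> (fun k => m (band a (E i k))) @ \oo --> psii i a.
    move=> Ba; apply: nonincreasing_is_cvgn; first exact: mono.
    by exists 0 => _ [k _ <-]; apply: fm.1; exact: balgI.
  have fpsii i : fadd B (psii i).
    by apply: (fadd_lim (u := fun k a => m (band a (E i k)))) => [k|a Ba];
      [exact: fadd_restrict|exact: psicv].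
  apply: (good_lim (u := psii)) => [i|a Ba].
    apply: (good_singular (E := E i)) => //.
    - apply: (cvg_near0 (C := 1)) => k /=.
      have B1 := BX (i + k)%N.
      have := fadd_le fmu (BE i k) B1 (@EX i k).
      have : 0 <= mu (E i k) by apply: fmu.1.
      have := muX (i + k)%N; have := half_pow_le R (leq_addl i k).
      by rewrite subr0 mul1r ler_norml => ? ? ? ?; apply/andP; split; lra.
    - move=> k; apply: (cvg_unique _ (psicv i (bneg (E i k)) (balgN (BE i k)))) => //.
      apply: cvg_near_cst; exists k => // l /= kl.
      rewrite -[RHS](fadd0 fm); congr m; apply/funext => x; rewrite /band /bneg.
      by have := @Emon i k l kl x; case: (E i l x); case: (E i k x) => // /(_ isT).
  (* The constant adds [2 * h i], for the distance from [psii i] to [u a i], and [h i], for the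
     distance from there to [psi]. *)
  apply: (cvg_near0 (C := 3)) => i.
  have d1 k : `|m (band a (E i k)) - u a i| <= 2 * h i.
    rewrite /u (fadd_split fm (balgI Ba (BX i)) (BE i k)).
    have -> : band (band a (X i)) (E i k) = band a (E i k).
      apply/funext => x; rewrite /band.
      have := @Emon i 0%N k (leq0n _) x; rewrite /E /=.
      by case: (a x); case: (X i x) => //=; case: (iteri _ _ _ x) => // /(_ isT).
    have BNk := balgN (BE i k).
    have p0 : 0 <= m (band (band a (X i)) (bneg (E i k))).
      by apply: fm.1; apply: balgI => //; exact: balgI.
    have : m (band (band a (X i)) (bneg (E i k))) <= m (band (X i) (bneg (E i k))).
      apply: (fadd_le fm) => //; do ?exact: balgI.
        by apply: balgI => //; exact: balgI.
      by move=> x; rewrite /band => /andP[/andP[_ ->] ->].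
    have := Em i k; have := half_pow_gt0 R (i + k).
    by rewrite ler_norml => ? ? ?; apply/andP; split; lra.
  have d2 : `|psii i a - u a i| <= 2 * h i.
    have hcv : (fun k => `|m (band a (E i k)) - u a i|) @ \oo --> `|psii i a - u a i|.
      by apply: cvg_norm; apply: cvgB; [exact: psicv|exact: cvg_cst].
    rewrite -(cvg_lim _ hcv)//; apply: limr_le.
      by apply/cvg_ex; exists `|psii i a - u a i|.
    by exists 0%N => // k _; exact: d1.
  have := psiu a i Ba; move: d2; rewrite !ler_norml.
  by move=> /andP[? ?] /andP[? ?]; apply/andP; split; lra.
have rest a i : B a -> m a - u a i = m (band a (bneg (X i))).
  by move=> Ba; rewrite /u [m a](fadd_split fm Ba (BX i)) addrC addKr.
have rcv a : B a -> (fun i => m (band a (bneg (X i)))) @ \oo --> m a - psi a.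
  move=> Ba; have -> : (fun i => m (band a (bneg (X i)))) = (fun i => m a - u a i).
    by apply/funext => i; rewrite rest.
  by apply: cvgB; [exact: cvg_cst|exact: ucv].
have frest : fadd B (fun a => m a - psi a).
  apply: fadd_lim rcv => i; exact: fadd_restrict.
have acrest : abs_cont (fun a => m a - psi a).
  move=> e e0; have [n [N hN]] := X3 e e0; exists (h n); first exact: half_pow_gt0.
  move=> a Ba mua; rewrite -(cvg_lim _ (rcv a Ba))//; apply: limr_le.
    by apply/cvg_ex; exists (m a - psi a); exact: rcv.
  by exists N => // i /= Ni; exact: hN.
apply: (good_ext (goodD gpsi (good_abs_cont frest acrest))) => a _; lra.
Qed.

End Decomposition.

(** * Densities of periodic sets *)

Section Periodic.
Implicit Types (c d : nat -> bool) (M N k : nat).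

Definition per c M := (0 < M)%N /\ forall i, c (i + M)%N = c i.

Definition periodic c := exists M, per c M.

Lemma per_addM c M : per c M -> forall i k, c (i + M * k)%N = c i.
Proof.
by move=> [_ h] i; elim=> [|k IH]; rewrite ?muln0 ?addn0// mulnS addnCA addnC h IH.
Qed.

Lemma per_mod c M : per c M -> forall i, c (i %% M)%N = c i.
Proof. by move=> h i; rewrite [in RHS](divn_eq i M) addnC mulnC per_addM. Qed.

Lemma per_mulr c M k : per c M -> (0 < k)%N -> per c (M * k).
Proof. by move=> h k0; split=> [|i]; [rewrite muln_gt0 h.1|exact: per_addM]. Qed.

Lemma per_dvd c M N : per c M -> (0 < N)%N -> (M %| N)%N -> per c N.
Proof.
move=> h N0 /dvdnP[k E]; subst N; rewrite mulnC; apply: per_mulr => //.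
by move: N0; rewrite muln_gt0 => /andP[].
Qed.

Lemma per_band c d M : per c M -> per d M -> per (band c d) M.
Proof. by move=> [M0 hc] [_ hd]; split => // i; rewrite /band hc hd. Qed.

Lemma per_bneg c M : per c M -> per (bneg c) M.
Proof. by move=> [M0 hc]; split => // i; rewrite /bneg hc. Qed.

Lemma per_common c d : periodic c -> periodic d -> exists2 M, per c M & per d M.
Proof.
move=> [M hM] [N hN]; exists (M * N)%N; first exact: per_mulr hM hN.1.
by rewrite mulnC; exact: per_mulr hN hM.1.
Qed.

Lemma periodic_btop : periodic btop.
Proof. by exists 1%N; split. Qed.

Lemma periodic_bneg c : periodic c -> periodic (bneg c).
Proof. by move=> [M /per_bneg]; exists M. Qed.

Lemma periodic_band c d : periodic c -> periodic d -> periodic (band c d).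
Proof. by move=> hc hd; have [M h1 h2] := per_common hc hd; exists M; exact: per_band. Qed.

Definition residue (i M : nat) : nat -> bool := fun j => j == i %[mod M].

Lemma per_residue i M : (0 < M)%N -> per (residue i M) M.
Proof. by move=> M0; split => // j; rewrite /residue modnDr. Qed.

Definition cnt c M : nat := (\sum_(0 <= i < M) c i)%N.

Lemma cnt_mul c M k : per c M -> cnt c (M * k) = (k * cnt c M)%N.
Proof.
move=> h; elim: k => [|k IH]; first by rewrite muln0 mul0n /cnt big_nil.
rewrite mulnS addnC /cnt (big_cat_nat (n := M * k)%N) ?leq_addr//= -/(cnt _ _) IH.
rewrite -[X in index_iota X]add0n big_addn addKn mulSn addnC; congr (_ + _)%N.
by apply: eq_bigr => i _; rewrite per_addM.
Qed.

Variable R : realType.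

(* The Haar measure of the clopen subset of the profinite integers with
   trace [c]; junk if [c] is not periodic. *)
Definition dens c : R :=
  (fun M => (cnt c M)%:R / M%:R) (xget 1%N [set M | per c M]).

(** The chosen period and [M] are compared through their product. *)
Lemma densE c M : per c M -> dens c = (cnt c M)%:R / M%:R.
Proof.
move=> h; have := xgetPex 1%N (ex_intro _ M h : exists M, [set M | per c M] M).
rewrite /dens; set N := xget _ _ => /= hN.
have M0 : (M%:R : R) != 0 by rewrite pnatr_eq0 -lt0n h.1.
have N0 : (N%:R : R) != 0 by rewrite pnatr_eq0 -lt0n hN.1.
have : (cnt c (N * M))%:R = (cnt c (M * N))%:R :> R by rewrite mulnC.
rewrite (cnt_mul _ hN) (cnt_mul _ h) !natrM => E.
by apply/eqP; rewrite eqr_div// mulrC E mulrC.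
Qed.

Lemma dens_ge0 c : 0 <= dens c.
Proof. by rewrite /dens divr_ge0. Qed.

Lemma dens_btop : dens btop = 1.
Proof. by have h : per btop 1 by []; rewrite (densE h) /cnt big_nat1 divr1. Qed.

Lemma dens_split c d : periodic c -> periodic d ->
  dens (band c d) + dens (band c (bneg d)) = dens c.
Proof.
move=> hc hd; have [M h1 h2] := per_common hc hd.
rewrite (densE (per_band h1 h2)) (densE (per_band h1 (per_bneg h2))) (densE h1).
rewrite -mulrDl -natrD; congr (_%:R / _); rewrite /cnt -big_split/=.
by apply: eq_bigr => i _; rewrite /band /bneg; case: (c i); case: (d i).
Qed.

Lemma dens_residue i M : (0 < M)%N -> dens (residue i M) = M%:R^-1.
Proof.
move=> M0; rewrite (densE (per_residue i M0)) -[RHS]div1r; congr (_ / _).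
rewrite /cnt big_mkord (bigD1 (Ordinal (ltn_pmod i M0)))//=.
rewrite /residue modn_mod eqxx big1 ?addn0// => j /eqP nj.
rewrite (modn_small (ltn_ord j)); case: eqP => // E; case: nj.
exact: val_inj.
Qed.

End Periodic.

(** * Sequences of periodic sets and their limit density *)

Section Rows.
Variable R : realType.
Notation U := (nat * nat -> bool).
Implicit Types (a b : U) (c d : nat -> bool).

Definition row n a : nat -> bool := fun i => a (n, i).

Definition rowper a := forall n, periodic (row n a).

Lemma rowperT : rowper btop.
Proof. by move=> n; exact: periodic_btop. Qed.

Lemma rowperN a : rowper a -> rowper (bneg a).
Proof. by move=> h n; exact: (periodic_bneg (h n)). Qed.

Lemma rowperI a b : rowper a -> rowper b -> rowper (band a b).
Proof. by move=> h h' n; exact: (periodic_band (h n) (h' n)). Qed.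

Definition rowperA : boolalg (nat * nat) := BoolAlg rowperT rowperN rowperI.

Definition lam n a : R := dens R (row n a).

Lemma lam_fadd n : fadd rowperA (lam n).
Proof. by split => [a _|a b ha hb]; [exact: dens_ge0|exact: dens_split (ha n) (hb n)]. Qed.

Lemma lam_btop n : lam n btop = 1.
Proof. exact: dens_btop. Qed.

Definition mu a : R := lim (lam^~ a @ \oo).

Definition bcst c : U := fun x => c x.2.

Lemma rowper_bcst c : periodic c -> rowper (bcst c).
Proof. by move=> hc n; exact: hc. Qed.

Lemma mu_bcst c : mu (bcst c) = dens R c.
Proof. by apply/cvg_lim => //; exact: (cvg_cst (dens R c)). Qed.

Definition evconst a := rowper a /\
  exists2 c, periodic c & exists n0, forall n, (n0 <= n)%N -> row n a = c.

Lemma evconst_bcst c : periodic c -> evconst (bcst c).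
Proof. by move=> hc; split; [exact: rowper_bcst|exists c => //; exists 0%N]. Qed.

Lemma evconst_cvg a c n0 : (forall n, (n0 <= n)%N -> row n a = c) ->
  lam^~ a @ \oo --> dens R c.
Proof. by move=> h; apply: cvg_near_cst; exists n0 => // n /= /h; rewrite /lam => ->. Qed.

End Rows.

Lemma cvgn_sum (R : realType) (I : Type) (r : seq I) (u : I -> nat -> R) (l : I -> R) :
  (forall i, u i @ \oo --> l i) ->
  (fun n => \sum_(i <- r) u i n) @ \oo --> \sum_(i <- r) l i.
Proof.
move=> h; elim: r => [|i r IH].
  have -> : (fun n => \sum_(i <- [::]) u i n) = cst 0.
    by apply/funext => n; rewrite big_nil.
  by rewrite big_nil; exact: cvg_cst.
have -> : (fun n => \sum_(j <- i :: r) u j n) = (fun n => u i n + \sum_(j <- r) u j n).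
  by apply/funext => n; rewrite big_cons.
by rewrite big_cons; apply: cvgD.
Qed.

(** * Goodness of all measures on an algebra with metrizable null sets *)

Section AllGood.
Variables (R : realType) (B : boolalg (nat * nat)).
Notation U := (nat * nat -> bool).
Implicit Types (a b : U) (c d : nat -> bool) (m : U -> R).
Notation mu := (mu R).
Notation lam := (lam R).
Hypothesis B_rowper : forall a, B a -> rowper a.
Hypothesis B_cvg : forall a, B a -> cvgn (lam^~ a).
Hypothesis B_evconst : forall a, evconst a -> B a.
Hypothesis B_dense : forall a, B a -> forall e : R, 0 < e ->
  exists2 c, periodic c & mu (bxor a (bcst c)) <= e.
(** Closed [mu]-null sets have only countably many clopen traces, hence are metrizable. *)
Hypothesis B_null_trace : forall E : nat -> U, (forall k, B (E k)) ->
  (forall k, bsub (E k.+1) (E k)) -> mu \o E @ \oo --> (0 : R) ->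
  exists S : nat -> U, (forall j, B (S j)) /\
    forall a, B a -> exists k j, band a (E k) = band (S j) (E k).

Lemma lam_faddB n : fadd B (lam n).
Proof.
have [h1 h2] := lam_fadd R n; split=> [a Ba|a b Ba Bb].
  by apply: h1; exact: B_rowper.
by apply: h2; exact: B_rowper.
Qed.

Lemma mu_fadd : fadd B mu.
Proof. by apply: fadd_lim lam_faddB _ => a Ba; exact: B_cvg. Qed.

Lemma good_singular m (E : nat -> U) : fadd B m ->
  (forall k, B (E k)) -> (forall k, bsub (E k.+1) (E k)) ->
  mu \o E @ \oo --> (0 : R) -> (forall k, m (bneg (E k)) = 0) -> good B m.
Proof.
move=> fm BE E1 E0 mE; have [S [BS tr]] := B_null_trace BE E1 E0.
exact: good_tower fm BE BS mE tr.
Qed.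

Lemma bcst_in c : periodic c -> B (bcst c).
Proof. by move=> hc; apply: B_evconst; exact: evconst_bcst. Qed.

Lemma residue_in i M : (0 < M)%N -> B (bcst (residue i M)).
Proof. by move=> M0; apply: bcst_in; exists M; exact: per_residue. Qed.

(** [lam n] lives on the [n]-th row, a clopen set [e] that is itself [mu]-null; the singular case
    applies with the constant sequence [e]. *)
Lemma good_lam n b : B b -> good B (fun a => lam n (band a b)).
Proof.
move=> Bb; pose e : U := fun x => x.1 == n.
have eB : B e.
  apply: B_evconst; split.
    by move=> k; exists 1%N; split.
  exists (bneg btop); first by exists 1%N; split.
  exists n.+1 => k nk; apply/funext => i; rewrite /row /e /bneg /=.
  by rewrite gtn_eqF.
apply: (good_singular (E := fun=> e)) => //.
- exact: fadd_restrict (lam_faddB n) Bb.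
- by move=> k x.
- apply: cvg_near_cst; exists 0%N => // k _ /=; apply/cvg_lim => //; apply: cvg_near_cst.
  exists n.+1 => // j /= nj; rewrite -[RHS](fadd0 (lam_faddB j)) /lam; congr dens.
  by apply/funext => i; rewrite /row /e /bneg /= gtn_eqF.
- move=> k; rewrite -[RHS](fadd0 (lam_faddB n)) /lam; congr dens.
  by apply/funext => i; rewrite /row /e /bneg /band /= eqxx.
Qed.

Lemma fadd_residues m M a : fadd B m -> (0 < M)%N -> B a ->
  m a = \sum_(i < M) m (band a (bcst (residue i M))).
Proof.
move=> fm M0 Ba.
(* The union of the first [K] residue classes, for an induction on [K]. *)
pose r K : nat -> bool := fun j => (j %% M < K)%N.
have rB K : B (bcst (r K)) by apply: bcst_in; exists M; split => // j; rewrite /r modnDr.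
suff h K : (K <= M)%N -> m (band a (bcst (r K))) =
    \sum_(i < K) m (band a (bcst (residue i M))).
  rewrite -h//; congr m; apply/funext => x; rewrite /band /bcst /r.
  by rewrite ltn_pmod// andbT.
elim: K => [_|K IH KM].
  rewrite big_ord0 -[RHS](fadd0 fm); congr m.
  by apply/funext => x; rewrite /band /bcst /r andbF.
rewrite big_ord_recr/= -IH; last exact: ltnW.
rewrite (fadd_split fm (balgI Ba (rB K.+1)) (rB K)); congr (m _ + m _).
  apply/funext => x; rewrite /band /bcst /r ltnS -andbA; congr (_ && _).
  by apply/andP/idP => [[]//|h]; rewrite h ltnW.
apply/funext => x; rewrite /band /bcst /bneg /r /residue ltnS -andbA; congr (_ && _).
by rewrite -leqNgt -eqn_leq (modn_small KM).
Qed.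

Lemma fadd_bcst m M c : fadd B m -> per c M ->
  m (bcst c) = \sum_(i < M) (c i)%:R * m (bcst (residue i M)).
Proof.
move=> fm hc; have M0 := hc.1.
rewrite (fadd_residues fm M0); last by apply: bcst_in; exists M.
apply: eq_bigr => i _; have ci j : residue i M j -> c j = c i.
  by rewrite /residue => /eqP E; rewrite -(per_mod hc j) E per_mod.
case: (boolP (c i)) => hi; rewrite ?mul1r ?mul0r.
  congr m; apply/funext => x; rewrite /band /bcst.
  by case: (boolP (residue i M x.2)) => [/ci ->|_]; rewrite ?hi ?andbF.
rewrite -[RHS](fadd0 fm); congr m; apply/funext => x; rewrite /band /bcst /bneg.
by case: (boolP (residue i M x.2)) => [/ci ->|_]; rewrite ?(negbTE hi) ?andbF.
Qed.

Lemma fadd_xor m a b : fadd B m -> B a -> B b -> `|m a - m b| <= m (bxor a b).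
Proof.
move=> fm Ba Bb; have Bx := balgX Ba Bb.
have l1 : m a <= m (bxor a b) + m b.
  apply: le_trans (fadd_leU fm Bx Bb); apply: (fadd_le fm) => //; first exact: balgU.
  by move=> x; rewrite /bor /bxor; case: (a x); case: (b x).
have l2 : m b <= m (bxor a b) + m a.
  apply: le_trans (fadd_leU fm Bx Ba); apply: (fadd_le fm) => //; first exact: balgU.
  by move=> x; rewrite /bor /bxor; case: (a x); case: (b x).
by rewrite ler_norml; apply/andP; split; lra.
Qed.

Section Density.
Variables (m : U -> R) (M : nat).
Hypotheses (fm : fadd B m) (M0 : (0 < M)%N).

(* The martingale of [m] along residues: [density] is its conditional
   expectation mod [M], each residue class having measure [M%:R^-1]. *)
Definition density (i : nat) : R := M%:R * m (bcst (residue i M)).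

Definition weighted (nu : U -> R) a : R :=
  \sum_(i < M) density i * nu (band a (bcst (residue i M))).

Lemma density_ge0 i : 0 <= density i.
Proof. by apply: mulr_ge0 => //; apply: fm.1; exact: residue_in. Qed.

Lemma weighted_fadd nu : fadd B nu -> fadd B (weighted nu).
Proof.
move=> fnu; split => [a Ba|a b Ba Bb].
  apply: sumr_ge0 => i _; apply: mulr_ge0; first exact: density_ge0.
  by apply: fnu.1; apply: balgI => //; exact: residue_in.
rewrite /weighted -big_split/=; apply: eq_bigr => i _; rewrite -mulrDr.
by congr (_ * _); have [_ h] := fadd_restrict fnu (residue_in i M0); exact: h.
Qed.

(** It is the limit of the measures [weighted (lam n)], which are nonnegative combinations of
    restrictions of [lam n]. *)
Lemma good_weighted : good B (weighted mu).
Proof.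
apply: (good_lim (u := fun n => weighted (lam n))) => [n|a Ba].
  apply: good_sum => i; apply: goodZ; first exact: density_ge0.
  by apply: good_lam; exact: residue_in.
apply: cvgn_sum => i; apply: cvgM; first exact: cvg_cst.
by apply: B_cvg; apply: balgI => //; exact: residue_in.
Qed.

Lemma weighted_bcst c : per c M -> weighted mu (bcst c) = m (bcst c).
Proof.
move=> hc; rewrite (fadd_bcst fm hc) /weighted; apply: eq_bigr => i _.
have -> : band (bcst c) (bcst (residue i M)) = bcst (band c (residue i M)) by [].
rewrite mu_bcst /density mulrAC; congr (_ * _).
have ci j : residue i M j -> c j = c i.
  by rewrite /residue => /eqP E; rewrite -(per_mod hc j) E per_mod.
have M1 : (M%:R : R) != 0 by rewrite pnatr_eq0 -lt0n.
case: (boolP (c i)) => hi.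
  have -> : band c (residue i M) = residue i M.
    apply/funext => j; rewrite /band.
    by case: (boolP (residue i M j)) => [/ci ->|_]; rewrite ?hi ?andbF.
  by rewrite dens_residue// mulfV.
have -> : band c (residue i M) = bneg btop.
  apply/funext => j; rewrite /band.
  by case: (boolP (residue i M j)) => [/ci ->|_]; rewrite ?(negbTE hi) ?andbF.
have -> : dens R (bneg btop) = 0.
  have := dens_split R periodic_btop periodic_btop; rewrite /=.
  have -> : band (btop : nat -> bool) btop = btop by btaut.
  have -> : band (btop : nat -> bool) (bneg btop) = bneg btop by btaut.
  lra.
by rewrite mulr0.
Qed.

(** Uniform integrability, with a bound independent of [M]. By Markov's inequality the classes of
    density above [L] have [mu]-measure at most [d], so they contribute at most [e] by absolute
    continuity; the others contribute at most [L * mu a]. *)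
Lemma weighted_uniform (L d e : R) a : 0 < L -> 0 <= e -> m btop <= L * d ->
  (forall b, B b -> mu b <= d -> m b <= e) -> B a -> L * mu a <= e ->
  weighted mu a <= e + e.
Proof.
move=> L0 e0 Ld ac Ba La.
pose big : nat -> bool := fun j => L < density (j %% M)%N.
have hbig : per big M by split => // j; rewrite /big modnDr.
have big_in : B (bcst big) by apply: bcst_in; exists M.
have M1 : (M%:R : R) != 0 by rewrite pnatr_eq0 -lt0n.
have mubig : mu (bcst big) <= d.
  rewrite -(ler_pM2l L0); apply: le_trans Ld.
  rewrite (fadd_bcst mu_fadd hbig) (fadd_residues fm M0 (balgT B)) mulr_sumr.
  apply: ler_sum => i _; rewrite mu_bcst dens_residue//.
  have -> : band btop (bcst (residue i M)) = bcst (residue i M) by btaut.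
  rewrite /big (modn_small (ltn_ord i)); case: ltP => [/ltW|_]; last first.
    by rewrite mul0r mulr0; apply: fm.1; exact: residue_in.
  by rewrite mul1r /density mulrC -ler_pdivlMr ?invrK ?invr_gt0 ?ltr0n// mulrC.
have mbig := ac _ big_in mubig.
apply: le_trans (lerD La mbig).
rewrite (fadd_bcst fm hbig) [mu a](fadd_residues mu_fadd M0 Ba) mulr_sumr -big_split/=.
apply: ler_sum => i _; rewrite /big (modn_small (ltn_ord i)).
have Bi := residue_in i M0.
have p0 : 0 <= mu (band a (bcst (residue i M))) by apply: mu_fadd.1; exact: balgI.
case: ltP => [hi|hi]; last by rewrite mul0r addr0 ler_wpM2r.
rewrite mul1r; apply: le_trans (_ : _ <= density i * mu (bcst (residue i M))) _.
  apply: ler_wpM2l; first exact: density_ge0.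
  by apply: (fadd_le mu_fadd) => //; [exact: balgI|move=> x /andP[]].
rewrite mu_bcst dens_residue// /density mulrAC mulfV// mul1r lerDr.
by apply: mulr_ge0 => //; exact: ltW.
Qed.

End Density.

(** Martingale convergence along the moduli [k!], which every period eventually divides. A set [a]
    is replaced by a periodic set, on which the weighted measure agrees with [m]; both errors are
    small, one by [weighted_uniform], the other by absolute continuity. *)
Lemma good_abs_cont m : fadd B m -> abs_cont B mu m -> good B m.
Proof.
move=> fm ac; apply: (good_lim (u := fun k => weighted m k`! mu)) => [k|a Ba].
  exact: good_weighted (fact_gt0 k).
apply/cvgrPdist_le => e e0.
have e3 : 0 < e / 3 by rewrite divr_gt0.
have [d d0 acd] := ac _ e3.
have m1 : 0 <= m btop by apply: fm.1; exact: balgT.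
(* The summand 1 keeps [L] positive when [m btop] is 0. *)
pose L := m btop / d + 1.
have L0 : 0 < L by rewrite ltr_wpDl// divr_ge0// ltW.
have Ld : m btop <= L * d by rewrite /L mulrDl mulfVK ?gt_eqF// lerDl mul1r ltW.
pose r := Num.min d (e / 3 / L).
have r0 : 0 < r by rewrite lt_min d0 divr_gt0.
have [c [P hP] muc] := B_dense Ba r0.
have Bc : B (bcst c) by apply: bcst_in; exists P.
have Bx := balgX Ba Bc.
exists P => // k /= Pk.
have hk : per c k`!.
  by apply: (per_dvd hP (fact_gt0 k)); apply: dvdn_fact; rewrite hP.1.
have fw := weighted_fadd fm (fact_gt0 k) mu_fadd.
have w1 := fadd_xor fw Ba Bc.
have w2 : weighted m k`! mu (bxor a (bcst c)) <= e / 3 + e / 3.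
  apply: (weighted_uniform fm (fact_gt0 k) L0 (ltW e3) Ld) => //.
  have : mu (bxor a (bcst c)) <= e / 3 / L.
    by apply: le_trans muc _; rewrite ge_min lexx orbT.
  by rewrite ler_pdivlMr// mulrC.
have w3 := fadd_xor fm Ba Bc.
have w4 : m (bxor a (bcst c)) <= e / 3.
  by apply: acd => //; apply: le_trans muc _; rewrite ge_min lexx.
have w5 := weighted_bcst fm (fact_gt0 k) hk.
move: w1 w3; rewrite w5 !ler_norml => /andP[? ?] /andP[? ?].
by apply/andP; split; lra.
Qed.

Lemma all_good m : fadd B m -> good B m.
Proof. exact: (@good_all R _ B mu mu_fadd good_singular good_abs_cont). Qed.

End AllGood.

(** * A well-order of type omega_1 *)

Section Continuum.
Variable R : realType.

Let q : R := 3^-1.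

(** Ternary expansions with digits 0 and 1 embed the Cantor space in the line. *)
Definition ternary_sum (s : nat -> bool) (n : nat) : R :=
  \sum_(k < n) (s k)%:R * q ^+ k.+1.

Lemma ternary_sumS s n : ternary_sum s n.+1 = ternary_sum s n + (s n)%:R * q ^+ n.+1.
Proof. by rewrite /ternary_sum big_ord_recr. Qed.

Let q_ge0 k : 0 <= q ^+ k.
Proof. by rewrite exprn_ge0// invr_ge0. Qed.

Lemma ternary_sum_homo s : {homo ternary_sum s : n p / (n <= p)%N >-> n <= p}.
Proof.
apply: homo_leq => //; first by move=> ? ? ?; exact: le_trans.
by move=> n; rewrite ternary_sumS lerDl mulr_ge0.
Qed.

(** [q ^+ k / 2] is the sum of all later powers of [q]; adding it turns the partial sums into
    nonincreasing upper bounds. *)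
Lemma ternary_sum_tail s k n :
  ternary_sum s (k + n) + q ^+ (k + n) / 2 <= ternary_sum s k + q ^+ k / 2.
Proof.
elim: n => [|n IH]; first by rewrite addn0.
apply: le_trans IH; rewrite addnS ternary_sumS.
have h : q ^+ (k + n).+1 = q ^+ (k + n) / 3 by rewrite exprS /q mulrC.
rewrite h; have := q_ge0 (k + n); case: (s (k + n)%N) => /=; lra.
Qed.

Lemma ternary_sum_le s k n : ternary_sum s n <= ternary_sum s k + q ^+ k / 2.
Proof.
apply: le_trans (ternary_sum_tail s k n); rewrite -[leLHS]addr0; apply: lerD.
  by apply: ternary_sum_homo; exact: leq_addl.
by rewrite divr_ge0.
Qed.

Definition ternary (s : nat -> bool) : R := sup (range (ternary_sum s)).

Lemma ternary_has_sup s : has_sup (range (ternary_sum s)).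
Proof.
split; first by exists (ternary_sum s 0), 0%N.
by exists (ternary_sum s 0 + q ^+ 0 / 2) => _ [n _ <-]; exact: ternary_sum_le.
Qed.

(** The digit gained at the first difference is worth twice the largest possible tail after it. *)
Lemma ternary_lt (s t : nat -> bool) k : (forall j, (j < k)%N -> s j = t j) -> s k -> ~~ t k ->
  ternary t < ternary s.
Proof.
move=> st sk tk.
have E : ternary_sum s k = ternary_sum t k.
  by apply: eq_bigr => i _; rewrite st.
apply: le_lt_trans (_ : _ <= ternary_sum t k.+1 + q ^+ k.+1 / 2) _.
  apply: ge_sup; first by case: (ternary_has_sup t).
  by move=> _ [n _ <-]; exact: ternary_sum_le.
apply: lt_le_trans (_ : _ < ternary_sum s k.+1) _; last first.
  by apply: ub_le_sup; [case: (ternary_has_sup s)|exists k.+1].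
rewrite !ternary_sumS E sk (negbTE tk).
have : 0 < q ^+ k.+1 by rewrite exprn_gt0// invr_gt0.
by rewrite mul0r mul1r; lra.
Qed.

Lemma ternary_inj : injective ternary.
Proof.
move=> s t st; apply: contrapT => nst.
have ex : exists k, s k != t k.
  apply: contrapT => h; apply: nst; apply/funext => k; apply/eqP/negPn/negP => hk.
  by apply: h; exists k.
case: (ex_minnP ex) => k sk kmin.
have eqlt j : (j < k)%N -> s j = t j.
  by move=> jk; apply/eqP/negPn/negP => /kmin; rewrite leqNgt jk.
have [tk|tk] := boolP (t k).
  have nsk : ~~ s k by move: sk; rewrite tk; case: (s k).
  have := @ternary_lt t s k (fun j jk => esym (eqlt j jk)) tk nsk.
  by rewrite st ltxx.
have sk' : s k by move: sk; rewrite (negbTE tk); case: (s k).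
by have := @ternary_lt s t k eqlt sk' tk; rewrite st ltxx.
Qed.

(** The graph of a map from [I] to [X] is coded by a bit sequence, and that by a real. Thus the
    reals can index all countable data that the construction has to meet. *)
Lemma real_surj_seq (I X : countType) : X ->
  exists g : R -> (I -> X), forall t, exists r, g r = t.
Proof.
move=> x0.
pose D (s : nat -> bool) (i : I) : X := xget x0 [set x | s (pickle (i, x))].
pose inv r : nat -> bool := xget (fun=> false) [set s | ternary s = r].
exists (fun r => D (inv r)) => t.
pose s n := if unpickle n is Some ix then t ix.1 == ix.2 :> X else false.
exists (ternary s).
have -> : inv (ternary s) = s.
  apply: ternary_inj.
  exact: (xgetPex (fun=> false)
    (ex_intro _ s erefl : exists s', [set s' | ternary s' = ternary s] s')).
apply/funext => i; rewrite /D.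
have h x : s (pickle (i, x)) = (t i == x) by rewrite /s pickleK.
have := xgetPex x0 (ex_intro _ (t i) _ : exists x, [set x | s (pickle (i, x))] x).
by move=> /(_ _)/=; rewrite h => /(_ (eqxx _)); rewrite h => /eqP.
Qed.

Lemma countable_enum (T : choiceType) (A : set T) (x0 : T) : countable A ->
  exists e : nat -> T, forall y, A y -> exists n, e n = y.
Proof.
move=> /countable_injP[f fi]; exists (fun n => xget x0 [set y | A y /\ f y = n]) => y Ay.
exists (f y); have := xgetPex x0 (ex_intro _ y (conj Ay erefl) :
  exists z, [set z | A z /\ f z = f y] z).
by move=> [Az fz]; apply: fi => //; rewrite inE.
Qed.

Lemma real_uncountable : ~ countable [set: R].
Proof.
move=> /(@countable_enum R setT 0) [e he].
have [g hg] := @real_surj_seq nat bool true.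
have [r hr] := hg (fun n => ~~ g (e n) n).
have [n hn] := he r I.
have : g r n = ~~ g r n by rewrite [in LHS]hr hn.
by case: (g r n).
Qed.

Record omega1_order (lt : R -> R -> Prop) := Omega1Order {
  omega1_wf : well_founded lt;
  omega1_trans : forall x y z, lt x y -> lt y z -> lt x z;
  omega1_total : forall x y, [\/ lt x y, x = y | lt y x];
  omega1_countable : forall x, countable [set y | lt y x] }.

(** Otherwise the line would be a countable union of countable initial segments. *)
Lemma omega1_bounded lt : omega1_order lt -> forall s : nat -> R,
  exists w, forall n, lt (s n) w.
Proof.
move=> lto s; apply: contrapT => nex; apply: real_uncountable.
have -> : [set: R] = \bigcup_n ([set s n] `|` [set w | lt w (s n)]).
  apply/seteqP; split => // w _; apply: contrapT => hw; apply: nex; exists w => n.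
  have [//|E|l] := omega1_total lto (s n) w; exfalso; apply: hw; exists n => //.
    by left.
  by right.
apply: bigcup_countable => // n _; rewrite -bigcup2E; apply: bigcup_countable => //.
move=> [|[|i]] _ /=; [exact: countable1|exact: (omega1_countable lto)|exact: countable0].
Qed.

(** The relation [le] is given only through unique minima of nonempty predicates; the order axioms
    come from minima of sets of at most three elements. *)
Lemma exists_wo (T : eqType) : exists lt : T -> T -> Prop,
  [/\ well_founded lt, forall x y z, lt x y -> lt y z -> lt x z &
      forall x y, [\/ lt x y, x = y | lt y x]].
Proof.
have [le wo] := well_ordering_principle T.
have min (A : set T) x : A x -> exists2 z, A z & forall y, A y -> le z y.
  move=> Ax; have [|z [[Az zl] _]] := wo [pred y | `[< A y >]].
    by exists x; rewrite inE.
  exists z; first by move: Az; rewrite inE.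
  by move=> y Ay; apply: zl; rewrite inE.
have refl x : le x x by have [z -> h] := min [set x] x erefl; exact: h.
have anti x y : le x y -> le y x -> x = y.
  move=> xy yx; have [|z [_ u]] := wo [pred t | (t == x) || (t == y)].
    by exists x; rewrite inE eqxx.
  have zx : z = x.
    apply: u; split; first by rewrite inE eqxx.
    by move=> t; rewrite inE => /orP[] /eqP ->; [exact: refl|exact: xy].
  have zy : z = y.
    apply: u; split; first by rewrite inE eqxx orbT.
    by move=> t; rewrite inE => /orP[] /eqP ->; [exact: yx|exact: refl].
  by rewrite -zx -zy.
have tot x y : le x y \/ le y x.
  have [|z zxy h] := min [set t | t = x \/ t = y] x; first by left.
  by case: zxy => <-; [left|right]; apply: h; [right|left].
have trans x y z : le x y -> le y z -> le x z.
  move=> xy yz; have [|t tA h] := min [set t | [\/ t = x, t = y | t = z]] x.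
    by constructor 1.
  have tx : le t x by apply: h; constructor 1.
  have ty : le t y by apply: h; constructor 2.
  have tz : le t z by apply: h; constructor 3.
  case: tA => E; subst t => //; first by rewrite (anti _ _ xy tx).
  by rewrite -(anti _ _ yz ty).
exists (fun x y => le x y /\ x <> y); split.
- move=> x; apply: contrapT => nx.
  have [z nz h] := min [set y | ~ Acc (fun x y => le x y /\ x <> y) y] x nx.
  apply: nz; constructor => y [yz ne]; apply: contrapT => ny.
  by apply: ne; apply: anti => //; exact: h.
- move=> x y z [xy nxy] [yz nyz]; split; first exact: trans yz.
  by move=> E; subst z; apply: nxy; exact: anti.
- move=> x y; have [->|/eqP ne] := eqVneq x y; first by constructor 2.
  by have [xy|yx] := tot x y; [constructor 1|constructor 3; split => // /esym].
Qed.

(** If some initial segment of a well-order of the line is uncountable, take the first such. By CH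
    the line injects into it, and the order pulled back along the injection has countable initial
    segments. *)
Lemma CH_omega1 : CH R -> exists lt, omega1_order lt.
Proof.
move=> hCH; have [lt [wf tr tot]] := exists_wo R.
have [f finj fseg] : exists2 f : R -> R, injective f &
    forall x, countable [set y | lt y (f x)].
  have [h|h] := pselect (forall x, countable [set y | lt y x]).
    by exists id.
  have [x nx xmin] : exists2 x, ~ countable [set y | lt y x] &
      forall z, lt z x -> countable [set y | lt y z].
    apply: contrapT => nex; apply: h => x; elim/(well_founded_ind wf): x => x IH.
    by apply: contrapT => nx; apply: nex; exists x.
  have [//|/pcard_leP[f]] := hCH [set y | lt y x].
  exists f; last by move=> y; apply: xmin; exact: (@funS _ _ _ _ f).
  by move=> a b; apply: (@inj _ _ _ f); rewrite inE.
exists (fun x y => lt (f x) (f y)); split.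
- suff h y : forall x, f x = y -> Acc (fun x y => lt (f x) (f y)) x.
    by move=> x; exact: (h _ x erefl).
  elim/(well_founded_ind wf): y => y IH x fx; constructor => z; rewrite fx => fz.
  exact: (IH _ fz).
- by move=> x y z; exact: tr.
- move=> x y; have [h|/finj h|h] := tot (f x) (f y);
    by [constructor 1|constructor 2|constructor 3].
- move=> x; apply/countable_injP; have /countable_injP[g gi] := fseg x.
  exists (g \o f) => a b; rewrite !inE /= => ha hb E.
  by apply: finj; apply: gi; rewrite ?inE.
Qed.

End Continuum.

(** * The construction *)

Section Generated.
Notation U := (nat * nat -> bool).
Implicit Types (a b : U) (G : set U).

(* Even [G = set0] generates all eventually constant sequences of rows. *)
Inductive gen G : U -> Prop :=
| gen_base a : evconst a -> gen G a
| gen_in a : G a -> gen G a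
| gen_neg a : gen G a -> gen G (bneg a)
| gen_and a b : gen G a -> gen G b -> gen G (band a b).

Lemma evconst_btop : evconst btop.
Proof. by split; [exact: rowperT|exists btop; [exact: periodic_btop|exists 0%N]]. Qed.

Definition genA G : boolalg (nat * nat) :=
  BoolAlg (gen_base G evconst_btop) (@gen_neg G) (@gen_and G).

Lemma gen_sub G G' : (forall a, G a -> gen G' a) -> forall a, gen G a -> gen G' a.
Proof.
move=> h a; elim=> {a} [a|a /h//|a _|a b _ ha _ hb].
- exact: gen_base.
- exact: gen_neg.
- exact: gen_and.
Qed.

Lemma gen_rowper G : (forall a, G a -> rowper a) -> forall a, gen G a -> rowper a.
Proof.
move=> h a; elim=> {a} [a []//|a /h//|a _|a b _ ha _ hb].
- exact: rowperN.
- exact: rowperI.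
Qed.

Lemma evconst_enum : exists e : nat -> U, forall a, evconst a -> exists n, e n = a.
Proof.
(* The code of a set: one period for each exceptional row, and one period common to all later
   rows. *)
pose h (t : seq (seq bool) * seq bool) : U := fun x =>
  let r := nth t.2 t.1 x.1 in nth false r (x.2 %% size r).
have hper c M : per c M -> forall i, nth false (mkseq c M) (i %% size (mkseq c M)) = c i.
  by move=> hc i; rewrite size_mkseq nth_mkseq ?ltn_pmod ?hc.1// per_mod.
exists (fun n => if unpickle n is Some t then h t else btop).
move=> a [ra [c [P hP] [n0 hn0]]]; have [M hM] := choice ra.
pose t := (mkseq (fun n => mkseq (row n a) (M n)) n0, mkseq c P).
exists (pickle t); rewrite pickleK; apply/funext => -[n i]; rewrite /h /=.
rewrite -[RHS]/(row n a i); have [nn0|nn0] := ltnP n n0; last rewrite (hn0 n nn0).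
  have -> : nth (mkseq c P) (mkseq (fun n => mkseq (row n a) (M n)) n0) n =
      mkseq (row n a) (M n) by rewrite nth_mkseq.
  exact: (hper _ _ (hM n)).
have -> : nth (mkseq c P) (mkseq (fun n => mkseq (row n a) (M n)) n0) n = mkseq c P.
  by rewrite nth_default ?size_mkseq.
exact: (hper _ _ hP).
Qed.

Lemma gen_enum G : (exists g : nat -> U, forall a, G a -> exists n, g n = a) ->
  exists e : nat -> U, (forall n, gen G (e n)) /\ forall a, gen G a -> exists n, e n = a.
Proof.
move=> [g hg]; have [f hf] := evconst_enum.
(* Boolean terms are coded by trees, whose odd leaves are values of [g] and whose even leaves are
   eventually constant sets. *)
pose lv n := if odd n then g n./2 else f n./2.
pose ev := fix ev (t : GenTree.tree nat) : U :=
  match t with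
  | GenTree.Leaf n => lv n
  | GenTree.Node _ [:: t] => bneg (ev t)
  | GenTree.Node _ (t :: t' :: _) => band (ev t) (ev t')
  | _ => btop
  end.
have evP a : gen G a -> exists t, ev t = a.
  elim=> {a} [a /hf[n <-]|a /hg[n <-]|a _ [t <-]|a b _ [t <-] _ [t' <-]].
  - by exists (GenTree.Leaf n.*2); rewrite /= /lv odd_double doubleK.
  - by exists (GenTree.Leaf n.*2.+1); rewrite /= /lv /= odd_double /= uphalf_double.
  - by exists (GenTree.Node 0 [:: t]).
  - by exists (GenTree.Node 0 [:: t; t']).
pose e0 n := if unpickle n is Some t then ev t else btop.
(* [g] may take values outside [G]; terms that leave the algebra are replaced by [btop]. *)
exists (fun n => if pselect (gen G (e0 n)) then e0 n else btop); split.
  by move=> n; case: pselect => [?|?] //=; exact: (gen_base G evconst_btop).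
move=> a ga; have [t ta] := evP a ga; exists (pickle t).
have E : e0 (pickle t) = a by rewrite /e0 pickleK.
by rewrite E; case: pselect.
Qed.

Definition bmix A a b : U := bor (band a A) (band b (bneg A)).

(** Normal form over one new generator: such mixtures are closed under the Boolean operations. *)
Lemma gen_extend G A a : gen (G `|` [set A]) a ->
  exists b1 b2, [/\ gen G b1, gen G b2 & a = bmix A b1 b2].
Proof.
have BT : gen G btop by apply: gen_base; exact: evconst_btop.
elim=> {a} [a ea|a [Ga| ->]|a _ [b1 [b2 [h1 h2 ->]]]|
            a b _ [b1 [b2 [h1 h2 ->]]] _ [b3 [b4 [h3 h4 ->]]]].
- by exists a, a; split; [exact: gen_base|exact: gen_base|rewrite /bmix; btaut].
- by exists a, a; split; [exact: gen_in|exact: gen_in|rewrite /bmix; btaut].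
- by exists btop, (bneg btop); split => //; [exact: gen_neg|rewrite /bmix; btaut].
- by exists (bneg b1), (bneg b2); split; [exact: gen_neg|exact: gen_neg|rewrite /bmix; btaut].
- by exists (band b1 b3), (band b2 b4); split; [exact: gen_and|exact: gen_and|rewrite /bmix; btaut].
Qed.

Variable R : realType.
Notation lam := (lam R).

Lemma gen_extend_cvg G A : (forall a, G a -> rowper a) -> rowper A ->
  (forall a, gen G a -> cvgn (lam^~ a)) ->
  (forall a, gen G a -> cvgn (fun n => lam n (band a A))) ->
  forall a, gen (G `|` [set A]) a -> cvgn (lam^~ a).
Proof.
move=> hG hA h1 h2 a /gen_extend[b1 [b2 [g1 g2 ->]]].
have r1 := gen_rowper hG g1; have r2 := gen_rowper hG g2.
have -> : lam^~ (bmix A b1 b2) = (fun n => lam n (band b1 A) + (lam n b2 - lam n (band b2 A))).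
  apply/funext => n; have fl := lam_fadd R n.
  have rm : rowperA (bmix A b1 b2).
    by apply: (@balgU _ rowperA); apply: balgI => //; exact: (@balgN _ rowperA).
  rewrite (fadd_split fl rm (hA : rowperA A)).
  rewrite [lam n b2](fadd_split fl (r2 : rowperA b2) (hA : rowperA A)).
  rewrite addrAC subrr add0r; congr (lam n _ + lam n _); rewrite /bmix; btaut.
by apply: is_cvgD; [exact: h2|apply: is_cvgB; [exact: h1|exact: h2]].
Qed.

End Generated.

(** With [N m] the threshold for [P m], the index [f n] is the largest [m <= n] with [N m <= n]. *)
Lemma slow_index (P : nat -> nat -> Prop) :
  (forall m, exists N, forall n, (N <= n)%N -> P m n) ->
  exists f : nat -> nat, (forall K, exists N, forall n, (N <= n)%N -> (K <= f n)%N) /\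
    exists N, forall n, (N <= n)%N -> P (f n) n.
Proof.
move=> h; have [N hN] := choice h.
have ex n : exists m, (N 0%N <= n)%N ->
    (N m <= n)%N /\ forall k, (k <= n)%N -> (N k <= n)%N -> (k <= m)%N.
  have [n0|n0] := leqP (N 0%N) n; last by exists 0%N.
  have exP : exists m, (m <= n)%N && (N m <= n)%N by exists 0%N.
  have ub m : (m <= n)%N && (N m <= n)%N -> (m <= n)%N by case/andP.
  case: (ex_maxnP exP ub) => m /andP[_ Nm] hm; exists m => _; split => // k kn Nk.
  by apply: hm; rewrite kn.
have [f hf] := choice ex; exists f; split.
  move=> K; exists (maxn (N 0%N) (maxn K (N K))) => n.
  by rewrite !geq_max => /and3P[/hf[_ h'] Kn NK]; exact: h'.
by exists (N 0%N) => n /hf[Nf _]; exact: hN.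
Qed.

(** * Adding one set to a countable algebra *)

Section OneStep.
Variables (R : realType) (B : boolalg (nat * nat)).
Notation U := (nat * nat -> bool).
Implicit Types (a b : U) (c d : nat -> bool).
Notation mu := (mu R).
Notation lam := (lam R).
Notation h := (half_pow R).
Hypothesis B_rowper : forall a, B a -> rowper a.
Hypothesis B_cvg : forall a, B a -> cvgn (lam^~ a).
Variable e : nat -> U.
Hypothesis B_e : forall n, B (e n).
Hypothesis e_surj : forall a, B a -> exists n, e n = a.
Hypothesis B_evconst : forall a, evconst a -> B a.
Hypothesis B_dense : forall a, B a -> forall e : R, 0 < e ->
  exists2 c, periodic c & mu (bxor a (bcst c)) <= e.
Variable F : nat -> nat -> U.
Hypothesis B_F : forall j k, B (F j k).
Hypothesis F_null : forall j, mu \o F j @ \oo --> (0 : R).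
Variable T : nat -> nat -> nat -> nat -> seq nat.
(** The number of residues is bounded independently of the modulus, with the value at [M = 0] as
    bound, so that [M] can then be chosen large against it. *)
Hypothesis T_size : forall j k n M, (size (T j k n M) <= size (T j k n 0%N))%N.

Let mu_fadd := mu_fadd B_rowper B_cvg.

Lemma dens_avoid (s : seq nat) M : (0 < M)%N ->
  dens R (fun i => ~~ all (fun r => i != r %[mod M]) s) <= (size s)%:R / M%:R.
Proof.
move=> M0; have p (t : seq nat) : per (fun i => ~~ all (fun r => i != r %[mod M]) t) M.
  by split => // i; congr (~~ _); apply: eq_all => r; rewrite modnDr.
elim: s => [|r s IH].
  rewrite (densE R (p [::])) /cnt big1 ?mul0r//.
have pr := per_residue r M0.
rewrite [leLHS](_ : _ = dens R (bor (residue r M)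
    (fun i => ~~ all (fun r => i != r %[mod M]) s))); last first.
  by congr dens; apply/funext => i; rewrite /bor /residue /= negb_and negbK.
set c := residue r M in pr *; set d := (fun i => ~~ _) in IH *.
have pd : periodic d by exists M; exact: p.
have pc : periodic c by exists M.
have pcd : periodic (bor c d).
  have -> : bor c d = bneg (band (bneg c) (bneg d)) by btaut.
  by apply: periodic_bneg; apply: periodic_band; exact: periodic_bneg.
rewrite -(dens_split R pcd pc).
have -> : band (bor c d) c = c by btaut.
have -> : band (bor c d) (bneg c) = band d (bneg c) by btaut.
rewrite dens_residue//= -natr1 mulrDl mul1r addrC; apply: lerD => //.
apply: le_trans IH; rewrite -(dens_split R pd pc) lerDr; exact: dens_ge0.
Qed.

(** On row [n] the set [A] is [G (f n)] cut down by [V n]. Here [G m] omits one small member of each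
    of the first [m] null sequences, [f] grows so slowly that [lam n] is close to [mu] on [G (f n)],
    and [V n] omits residue classes of total density at most [h n]. *)
Lemma one_step : exists A : U,
  [/\ rowper A,
      forall b, B b -> cvgn (fun n => lam n (band b A)),
      forall e : R, 0 < e -> exists2 c, periodic c & mu (bxor A (bcst c)) <= e,
      2^-1 <= mu A &
      (forall j, exists k n0, forall n i, (n0 <= n)%N -> ~~ (A (n, i) && F j k (n, i))) /\
      (forall j n k, (j <= n)%N -> (k <= n)%N -> exists2 M, (0 < M)%N &
         forall r, r \in T j k n M -> forall i, A (n, i) -> i <> r %[mod M])].
Proof.
(* The bounds [h j.+2] add up to one half, so that [muG] leaves at least one half. *)
have hex j : exists k, mu (F j k) <= h j.+2.
  have /cvgrPdist_le /(_ _ (half_pow_gt0 R j.+2)) [N _ hN] := @F_null j.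
  exists N; have := hN N (leqnn N); rewrite /= sub0r normrN => /(le_trans _); apply.
  exact: ler_norm.
have [kk hkk] := choice hex.
pose G := fix G m := if m is m'.+1 then band (G m') (bneg (F m' (kk m'))) else btop.
have BG m : B (G m).
  elim: m => [|m IH]; first exact: balgT.
  by apply: balgI => //; exact: balgN.
have Gsub m p : (m <= p)%N -> bsub (G p) (G m).
  by move=> /subnK <-; elim: (p - m)%N => [//|j IH] x /andP[/IH].
have GF m j : (j < m)%N -> forall x, G m x -> ~~ F j (kk j) x.
  by move=> jm x /(Gsub _ _ jm) /andP[].
have muG m : 2^-1 + h m.+1 <= mu (G m).
  elim: m => [|m IH].
    rewrite /half_pow expr1 /=; have -> : mu btop = 1.
      by apply/cvg_lim => //; apply: cvg_near_cst; exists 0%N => // n _; exact: lam_btop.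
    lra.
  have BN := balgN (B_F m (kk m)).
  have E := fadd_split mu_fadd (BG m) (B_F m (kk m)).
  have : mu (band (G m) (F m (kk m))) <= mu (F m (kk m)).
    by apply: (fadd_le mu_fadd) => //; [exact: balgI|move=> x /andP[]].
  have -> : G m.+1 = band (G m) (bneg (F m (kk m))) by [].
  have := hkk m; have := half_powS R m.+1; lra.
(* The value that [mu (band b A)] will have. *)
pose l b := lim ((fun m => mu (band b (G m))) @ \oo).
have lmono b : B b -> {homo (fun m => mu (band b (G m))) : n p / (n <= p)%N >-> n >= p}.
  move=> Bb n p np; apply: (fadd_le mu_fadd); do ?exact: balgI.
  by move=> x /andP[bx /(Gsub _ _ np) gx]; apply/andP.
have lcv b : B b -> (fun m => mu (band b (G m))) @ \oo --> l b.
  move=> Bb; apply: nonincreasing_is_cvgn; first exact: lmono.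
  by exists 0 => _ [k _ <-]; apply: mu_fadd.1; exact: balgI.
(* Only the first [f n] members of the enumeration are controlled at row [n]; as [f] is unbounded,
   every member is controlled eventually. *)
have [f [f_oo [Nf hf]]] : exists f : nat -> nat,
    (forall K, exists N, forall n, (N <= n)%N -> (K <= f n)%N) /\
    exists N, forall n, (N <= n)%N -> forall i, (i <= f n)%N ->
      `|lam n (band (e i) (G (f n))) - mu (band (e i) (G (f n)))| <= h (f n).
  apply: (slow_index (P := fun m n => forall i, (i <= m)%N ->
    `|lam n (band (e i) (G m)) - mu (band (e i) (G m))| <= h m)) => m.
  have ex i : exists N, forall n, (N <= n)%N ->
      `|lam n (band (e i) (G m)) - mu (band (e i) (G m))| <= h m.
    have hc : lam^~ (band (e i) (G m)) @ \oo --> mu (band (e i) (G m)).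
      by apply: B_cvg; exact: balgI.
    move/cvgrPdist_le : hc => /(_ _ (half_pow_gt0 R m)) [N _ hN].
    by exists N => n /hN /=; rewrite distrC.
  have [N hN] := choice ex; exists (\sum_(i < m.+1) N i)%N => n sn i im.
  apply: hN; apply: leq_trans sn.
  by rewrite (bigD1 (Ordinal (im : (i < m.+1)%N)))//= leq_addr.
pose S n M := flatten [seq T jk.1 jk.2 n M | jk <-
  [seq (j, k) | j <- iota 0 n.+1, k <- iota 0 n.+1]].
have S_size n M : (size (S n M) <= size (S n 0%N))%N.
  rewrite /S; elim: [seq (j, k) | j <- _, k <- _] => [//|x s IH] /=.
  by rewrite !size_cat; apply: leq_add.
(* Each omitted class has density [1 / M n], and there are at most [size (S n 0)] of them; the
   successor keeps [M n] positive. *)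
pose M n := ((size (S n 0)).+1 * 2 ^ n)%N.
have M0 n : (0 < M n)%N by rewrite muln_gt0 expn_gt0.
pose V n : nat -> bool := fun i => all (fun r => i != r %[mod M n]) (S n (M n)).
have Vper n : per (V n) (M n).
  by split => // i; apply: eq_all => r; rewrite modnDr.
have Vdens n : dens R (bneg (V n)) <= h n.
  apply: le_trans (dens_avoid (S n (M n)) (M0 n)) _.
  rewrite ler_pdivrMr ?ltr0n ?M0// /M natrM natrX /half_pow mulrCA -exprMn.
  rewrite mulVf ?pnatr_eq0// expr1n mulr1 ler_nat.
  by apply: leq_trans (S_size _ _) _.
pose A : U := fun x => G (f x.1) x && V x.1 x.2.
have Arow k : row k A = band (row k (G (f k))) (V k) by apply/funext.
have Aper : rowper A.
  move=> n; rewrite Arow; apply: periodic_band; first exact: B_rowper.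
  by exists (M n).
have lamA n b : B b -> `|lam n (band b A) - lam n (band b (G (f n)))| <= h n.
  move=> Bb; have Bg : rowper (band b (G (f n))).
    by apply: B_rowper; exact: balgI.
  have pV : periodic (V n) by exists (M n).
  have E := dens_split R (Bg n) pV.
  have -> : lam n (band b A) = dens R (band (row n (band b (G (f n)))) (V n)).
    by congr dens; apply/funext => i; rewrite /row /band /A /= andbA.
  rewrite [lam n (band b (G _))]/(lam _ _) -E.
  have : dens R (band (row n (band b (G (f n)))) (bneg (V n))) <= dens R (bneg (V n)).
    have pN := periodic_bneg pV.
    rewrite -[leRHS](dens_split R pN (Bg n)).
    have -> : band (bneg (V n)) (row n (band b (G (f n)))) =
       band (row n (band b (G (f n)))) (bneg (V n)).
      by apply/funext => i; rewrite /band andbC.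
    by rewrite lerDl; exact: dens_ge0.
  have := dens_ge0 R (band (row n (band b (G (f n)))) (bneg (V n))).
  have := Vdens n; set z := dens R _; set w := dens R _; set y := dens R _.
  by rewrite ler_norml => ? ? ?; apply/andP; split; lra.
have Acv b : B b -> (fun n => lam n (band b A)) @ \oo --> l b.
  move=> Bb; apply/cvgrPdist_le => r r0.
  have r3 : 0 < r / 3 by rewrite divr_gt0.
  have [i ib] := e_surj Bb.
  have [N1 hN1] := half_pow_small r3.
  have /cvgrPdist_le /(_ _ r3) [N2 _ hN2] := lcv b Bb.
  have [N3 hN3] := f_oo (i + N1 + N2)%N.
  exists (Nf + N1 + N3)%N => // n /= hn.
  have n1 : (Nf <= n)%N by apply: leq_trans hn; rewrite -addnA leq_addr.
  have n2 : (N1 <= n)%N by apply: leq_trans hn; rewrite addnAC leq_addl.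
  have n3 : (i + N1 + N2 <= f n)%N.
    by apply: hN3; apply: leq_trans hn; rewrite leq_addl.
  have a1 := lamA n b Bb; have b1 := hN1 n n2.
  have a2 := hf n n1 i; rewrite ib in a2.
  have {}a2 := a2 (leq_trans (leq_trans (leq_addr _ _) (leq_addr _ _)) n3).
  have b2 := hN1 (f n) (leq_trans (leq_trans (leq_addl _ _) (leq_addr _ _)) n3).
  have := hN2 (f n) (leq_trans (leq_addl _ _) n3) => /= a3.
  move: a1 a2 a3; rewrite !ler_norml => /andP[? ?] /andP[? ?] /andP[? ?].
  by apply/andP; split; lra.
have ET a : band btop a = a by btaut.
have muA : mu A = l btop.
  by apply/cvg_lim => //; have := Acv _ (balgT B); rewrite ET.
exists A; split.
- exact: Aper.
- by move=> b Bb; apply/cvg_ex; exists (l b); exact: Acv.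
- move=> r r0; have r3 : 0 < r / 3 by rewrite divr_gt0.
  have /cvgrPdist_le /(_ _ r3) [m _ /(_ m (leqnn m)) /= hm] := lcv _ (balgT B).
  rewrite ET in hm.
  have [c pc mc] := B_dense (BG m) r3.
  have Bc : B (bcst c) by apply: B_evconst; exact: evconst_bcst.
  exists c => //.
  (* Since [A] is not known to be in [B], convergence here has to be drawn from convergence on [A],
     on [bcst c] and on their intersection. *)
  have AxE n : lam n (bxor A (bcst c)) =
     lam n A + lam n (bcst c) - 2 * lam n (band (bcst c) A).
    have fl := lam_fadd R n; have rc : rowperA (bcst c) := rowper_bcst pc.
    have rA : rowperA A := Aper; have rX := balgX rA rc.
    rewrite (fadd_split fl rX rc) [lam n A](fadd_split fl rA rc).
    rewrite [lam n (bcst c)](fadd_split fl rc rA).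
    have -> : band (bxor A (bcst c)) (bcst c) = band (bcst c) (bneg A) by btaut.
    have -> : band (bxor A (bcst c)) (bneg (bcst c)) = band A (bneg (bcst c)) by btaut.
    have -> : band A (bcst c) = band (bcst c) A by btaut.
    lra.
  have Axcv : cvgn (fun n => lam n (bxor A (bcst c))).
    rewrite (_ : (fun n => _) = fun n => lam n (band btop A) + lam n (bcst c)
        - 2 * lam n (band (bcst c) A)); last by apply/funext => n; rewrite AxE ET.
    apply: is_cvgB; first apply: is_cvgD.
    + by apply/cvg_ex; exists (l btop); exact: Acv (balgT B).
    + exact: B_cvg.
    + apply: is_cvgM; first exact: is_cvg_cst.
      by apply/cvg_ex; exists (l (bcst c)); exact: Acv.
  have Bx := balgX (BG m) Bc.
  (* On late rows [A] is contained in [G m], so its difference from [bcst c] is covered by [G m]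
     minus [A] and the difference of [G m] from [bcst c]. *)
  have ub : (fun n => lam n (G m) - lam n (band btop A) + lam n (bxor (G m) (bcst c))) @ \oo
     --> mu (G m) - l btop + mu (bxor (G m) (bcst c)).
    apply: cvgD; last exact: B_cvg.
    by apply: cvgB; [exact: B_cvg|exact: Acv (balgT B)].
  apply: le_trans (_ : _ <= mu (G m) - l btop + mu (bxor (G m) (bcst c))) _; last first.
    move: hm; rewrite ler_norml => /andP[? ?]; lra.
  rewrite -(cvg_lim _ ub)//; apply: ler_lim => //.
    by apply/cvg_ex; eexists; exact: ub.
  have [N hN] := f_oo m; exists N => // n /= /hN mf.
  have fl := lam_fadd R n; have rc : rowperA (bcst c) := rowper_bcst pc.
  have rA : rowperA A := Aper; have rX := balgX rA rc.
  have rG : rowperA (G m) := B_rowper (BG m).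
  have rX' := balgX rG rc.
  have AG : lam n (band (G m) A) = lam n A.
    congr dens; apply/funext => i; rewrite /row /band /A /=.
    by case: (boolP (G (f n) (n, i))) => [/(Gsub _ _ mf) ->|_]; rewrite /= ?andbF.
  rewrite ET [lam n (G m)](fadd_split fl rG rA) AG [lam n A + _]addrC addrK.
  have rN := balgI rG (balgN rA).
  have h1 := fadd_leU fl rN rX'; apply: le_trans h1.
  have -> : lam n (bxor A (bcst c)) = lam n (bxor (band (G m) A) (bcst c)).
    congr dens; apply/funext => i; rewrite /row /band /bxor /A /=.
    by case: (boolP (G (f n) (n, i))) => [/(Gsub _ _ mf) ->|_]; rewrite /= ?andbF.
  apply: (fadd_le fl).
  + by apply: balgX => //; exact: balgI.
  + exact: balgU.
  + by move=> x; rewrite /bxor /band /bor /bneg; case: (G m x); case: (A x); case: (bcst c x).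
- rewrite muA; apply: limr_ge; first by apply/cvg_ex; exists (l btop); exact: lcv (balgT B).
  exists 0%N => // m _ /=; rewrite ET; apply: le_trans (muG m).
  by rewrite lerDl ltW// half_pow_gt0.
- split.
    move=> j; have [N hN] := f_oo j.+1; exists (kk j), N => n i /hN jf.
    by rewrite /A /=; apply/negP => /andP[/andP[/(GF _ _ jf) /negP + _]].
  move=> j n k jn kn; exists (M n) => // r rT i /andP[_ /allP Vi].
  apply/eqP; apply: Vi; apply/flattenP; exists (T j k n (M n)) => //.
  apply/mapP; exists (j, k) => //; apply/allpairsP; exists (j, k).
  by rewrite !mem_iota /= !ltnS.
Qed.

End OneStep.

(** Transfinite recursion with choice. By [ext] the requirement at [w] sees only the values below
    [w], so the partial function built so far may be completed by [x0]. *)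
Lemma wf_choice (W : Type) (lt : W -> W -> Prop) (X : choiceType) (x0 : X)
    (P : W -> (W -> X) -> X -> Prop) : well_founded lt ->
  (forall w f f' x, (forall v, lt v w -> f v = f' v) -> P w f x -> P w f' x) ->
  (forall w f, (forall v, lt v w -> P v f (f v)) -> exists x, P w f x) ->
  exists f, forall w, P w f (f w).
Proof.
move=> wf ext ex.
pose ext0 w (rec : forall v, lt v w -> X) v :=
  if pselect (lt v w) is left H then rec v H else x0.
pose F w rec := xget x0 [set x | P w (@ext0 w rec) x].
pose f := Fix wf (fun=> X) F.
have fE w : f w = xget x0 [set x | P w (fun v => if pselect (lt v w) then f v else x0) x].
  rewrite /f Fix_eq//; last first.
    move=> {}w r r' rr; congr F; apply: functional_extensionality_dep => v.
    by apply: functional_extensionality_dep => H; exact: rr.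
  rewrite /F; congr xget; apply/funext => x /=; congr (P w _ x).
  by apply/funext => v; rewrite /ext0; case: pselect.
exists f => w; elim/(well_founded_ind wf): w => w IH.
have [x Px] := ex w f IH.
have e1 v : lt v w -> f v = (if pselect (lt v w) then f v else x0).
  by case: pselect.
apply: (ext w _ _ _ (fun v h => esym (e1 v h))); rewrite [X in P _ _ X]fE.
apply: (xgetPex x0 (_ : exists y, [set z | P w _ z] y)).
by exists x; exact: (ext _ _ _ _ e1 Px).
Qed.

Lemma inv_fact_le (R : realType) m : (m`!%:R)^-1 <= 2 * half_pow R m.
Proof.
elim: m => [|m IH]; first by rewrite fact0 invr1 /half_pow expr0; lra.
case: m IH => [|m] IH; first by rewrite invr1 /half_pow expr1; lra.
rewrite factS natrM invfM /half_pow exprS mulrCA.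
apply: ler_pM => //; rewrite ?invr_ge0// lef_pV2 ?posrE ?ltr0n//.
by rewrite ler_nat.
Qed.

(** * Transfinite recursion along the well-order *)

Section Construction.
Variables (R : realType) (lt : R -> R -> Prop).
Hypothesis lto : omega1_order lt.
Notation U := (nat * nat -> bool).
Notation mu := (mu R).
Notation lam := (lam R).
Variable task : R -> (nat * nat * nat -> bool * seq nat).

(* A task [v] provides a sequence of sets and a sequence of finite sets of
   points in the copies of the profinite integers, a point being given by its
   residues modulo all [M]: [task_list v k n M] lists the residues mod [M] of
   the points of the [k]-th set in the [n]-th copy. *)
Definition task_set v k : U := fun x => (task v (k, x.1, x.2)).1.
Definition task_list v k n M : seq nat := (task v (k, n, M)).2.

Definition stage (A : R -> U) (D : R -> Prop) : set U := [set A v | v in D].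

Definition below w : R -> Prop := fun v => lt v w.

(** [adm_avoid] makes the trace of [a] on given null sets trivial, [adm_miss] lets [a] escape
    finitely supported measures, and [adm_half] keeps [a] large all the same. *)
Record admissible w (A : R -> U) (a : U) : Prop := Admissible {
  adm_rowper : rowper a;
  adm_cvg : forall b, gen (stage A (below w)) b -> cvgn (fun n => lam n (band b a));
  adm_dense : forall e : R, 0 < e -> exists2 c, periodic c & mu (bxor a (bcst c)) <= e;
  adm_half : 2^-1 <= mu a;
  adm_avoid : forall v, lt v w -> (forall k, gen (stage A (below w)) (task_set v k)) ->
    mu \o task_set v @ \oo --> (0 : R) ->
    exists k n0, forall n i, (n0 <= n)%N -> ~~ (a (n, i) && task_set v k (n, i));
  adm_miss : forall v, lt v w ->
    (forall k n M, (size (task_list v k n M) <= size (task_list v k n 0))%N) ->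
    exists i0, forall n k, (i0 <= n)%N -> (k <= n)%N -> exists2 M, (0 < M)%N &
      forall r, r \in task_list v k n M -> forall i, a (n, i) -> i <> r %[mod M] }.

Lemma admissible_ext w A A' a : (forall v, lt v w -> A v = A' v) ->
  admissible w A a -> admissible w A' a.
Proof.
move=> AA; have E : stage A (below w) = stage A' (below w).
  by apply/seteqP; split => _ [v vw <-]; exists v; rewrite ?AA.
by move=> [h1 h2 h3 h4 h5 h6]; split => //; rewrite -E.
Qed.

Lemma stage_sub A (D D' : R -> Prop) : (forall v, D v -> D' v) ->
  forall a, gen (stage A D) a -> gen (stage A D') a.
Proof. by move=> DD'; apply: gen_sub => _ [v /DD' Dv <-]; apply: gen_in; exists v. Qed.

(** A member of the algebra involves finitely many generators, hence has a last one unless it is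
    eventually constant. *)
Lemma gen_stage A (D : R -> Prop) a : gen (stage A D) a ->
  evconst a \/ exists2 v, D v & gen (stage A (below v) `|` [set A v]) a.
Proof.
have mono v v' b : lt v v' -> gen (stage A (below v) `|` [set A v]) b ->
    gen (stage A (below v') `|` [set A v']) b.
  move=> vv'; apply: gen_sub => _ [[u uv <-]|->]; apply: gen_in; left.
    by exists u => //; exact: (omega1_trans lto) uv vv'.
  by exists v.
elim=> {a} [a ea|_ [v Dv <-]|a _ IH|a b _ IHa _ IHb].
- by left.
- by right; exists v => //; apply: gen_in; right.
- case: IH => [ea|[v Dv gv]]; last by right; exists v => //; exact: gen_neg.
  left; have [ra [c pc [n0 h]]] := ea; split; first exact: rowperN.
  exists (bneg c); first exact: periodic_bneg.
  by exists n0 => n /h <-.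
- have base v x : evconst x -> gen (stage A (below v) `|` [set A v]) x.
    exact: gen_base.
  case: IHa IHb => [[ra [c pc [n0 h]]]|[v Dv gv]] [eb|[v' Dv' gv']].
  + left; have [rb [d pd [n1 h1]]] := eb; split; first exact: rowperI.
    exists (band c d); first exact: periodic_band.
    exists (n0 + n1)%N => n nn.
    rewrite -(h n) ?(leq_trans (leq_addr _ _) nn)//.
    by rewrite -(h1 n) ?(leq_trans (leq_addl _ _) nn).
  + right; exists v' => //; apply: gen_and => //; apply: base; split => //.
    by exists c => //; exists n0.
  + by right; exists v => //; apply: gen_and => //; exact: base.
  + right; have [l|E|l] := omega1_total lto v v'.
    * by exists v' => //; apply: gen_and => //; exact: mono gv.
    * by subst v'; exists v => //; exact: gen_and.
    * by exists v => //; apply: gen_and => //; exact: mono gv'.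
Qed.

Lemma evconst_is_cvg a : evconst a -> cvgn (lam^~ a).
Proof.
by move=> [_ [c _ [n0 h]]]; apply/cvg_ex; exists (dens R c); exact: evconst_cvg h.
Qed.

Section Stage.
Variables (A : R -> U) (D : R -> Prop).
Hypothesis D_down : forall v w, lt v w -> D w -> D v.
Hypothesis D_adm : forall v, D v -> admissible v A (A v).

Lemma stage_rowper a : gen (stage A D) a -> rowper a.
Proof. by apply: gen_rowper => _ [v /D_adm[] + _ _ _ _ _ <-]. Qed.

(** Well-founded induction on the last generator, with [gen_extend_cvg] at each step. *)
Lemma stage_cvg a : gen (stage A D) a -> cvgn (lam^~ a).
Proof.
have rp v : D v -> forall b, stage A (below v) b -> rowper b.
  by move=> Dv _ [u uv <-]; have [] := D_adm (D_down uv Dv).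
have step v : D v -> (forall b, gen (stage A (below v)) b -> cvgn (lam^~ b)) ->
    forall b, gen (stage A (below v) `|` [set A v]) b -> cvgn (lam^~ b).
  move=> Dv h b; have adm := D_adm Dv.
  apply: gen_extend_cvg => //; [exact: rp|exact: (adm_rowper adm)|exact: (adm_cvg adm)].
have below_cvg v : D v -> forall b, gen (stage A (below v)) b -> cvgn (lam^~ b).
  elim/(well_founded_ind (omega1_wf lto)): v => v IH Dv b.
  move=> /gen_stage[/evconst_is_cvg//|[u uv]].
  have Du := D_down uv Dv; apply: step => //; exact: IH.
move=> /gen_stage[/evconst_is_cvg//|[u Du]]; apply: step => //; exact: below_cvg.
Qed.

Lemma stage_fadd : fadd (genA (stage A D)) mu.
Proof. by apply: mu_fadd => a; [exact: stage_rowper|exact: stage_cvg]. Qed.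

Lemma stage_dense a : gen (stage A D) a -> forall e : R, 0 < e ->
  exists2 c, periodic c & mu (bxor a (bcst c)) <= e.
Proof.
elim=> {a} [a [ra [c pc [n0 h]]]|_ [v /D_adm[_ _ h _ _ _] <-]|a _ IH|a b ga IHa gb IHb] e e0.
- exists c => //; suff -> : mu (bxor a (bcst c)) = 0 by exact: ltW.
  apply/cvg_lim => //; apply: cvg_near_cst; exists n0 => // n /= /h E.
  rewrite -[RHS](fadd0 (lam_fadd R n)); congr dens; apply/funext => i.
  by rewrite /row /bxor /bcst /= -[a (n, i)]/(row n a i) E addbb.
- exact: h.
- have [c pc hc] := IH e e0; exists (bneg c); first exact: periodic_bneg.
  rewrite (_ : bxor _ _ = bxor a (bcst c))//; apply/funext => x.
  by rewrite /bxor /bneg /bcst; case: (a x); case: (c x.2).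
- have e2 : 0 < e / 2 by rewrite divr_gt0.
  have [c pc hc] := IHa _ e2; have [d pd hd] := IHb _ e2.
  exists (band c d); first exact: periodic_band.
  have Bx x p : gen (stage A D) x -> periodic p -> genA (stage A D) (bxor x (bcst p)).
    by move=> gx pp; apply: balgX => //=; apply: gen_base; exact: evconst_bcst.
  have Ba := Bx a c ga pc; have Bb := Bx b d gb pd.
  have Bab := Bx _ _ (gen_and ga gb) (periodic_band pc pd).
  have := fadd_leU stage_fadd Ba Bb.
  have : mu (bxor (band a b) (bcst (band c d))) <=
      mu (bor (bxor a (bcst c)) (bxor b (bcst d))).
    apply: (fadd_le stage_fadd) => //; first exact: balgU.
    move=> x; rewrite /bxor /bor /band /bcst.
    by case: (a x); case: (b x); case: (c x.2); case: (d x.2).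
  lra.
Qed.

End Stage.

(** Only countably many indices precede [w], so the algebra so far and the earlier tasks can be
    enumerated for [one_step]. Tasks that violate the requirements are replaced by empty sets and
    empty lists. *)
Lemma admissible_exists w A : (forall v, lt v w -> admissible v A (A v)) ->
  exists a, admissible w A a.
Proof.
move=> adm; pose D := below w.
have down u v : lt u v -> D v -> D u by exact: (omega1_trans lto).
have [en hen] := countable_enum w (omega1_countable lto w).
have [e [ge esurj]] : exists e : nat -> U, (forall n, gen (stage A D) (e n)) /\
    forall a, gen (stage A D) a -> exists n, e n = a.
  apply: gen_enum; exists (A \o en) => _ [v /hen[n <-] <-]; by exists n.
pose okF j := lt (en j) w /\ (forall k, gen (stage A D) (task_set (en j) k)) /\
  mu \o task_set (en j) @ \oo --> (0 : R).
pose F j k : U := if pselect (okF j) then task_set (en j) k else bneg btop.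
pose okT j := forall k n M,
  (size (task_list (en j) k n M) <= size (task_list (en j) k n 0))%N.
pose T j k n M := if pselect (okT j) then task_list (en j) k n M else [::].
have fmu := stage_fadd down adm.
have BF j k : genA (stage A D) (F j k).
  rewrite /F; case: pselect => [[_ [h _]]|_] /=; first exact: h.
  exact: (balg0 (genA (stage A D))).
have F0 j : mu \o F j @ \oo --> (0 : R).
  rewrite /F; case: pselect => [[_ [_ h]]|_] //=.
  by apply: cvg_near_cst; exists 0%N => // k _ /=; exact: (fadd0 fmu).
have Tsize j k n M : (size (T j k n M) <= size (T j k n 0%N))%N.
  by rewrite /T; case: pselect => [ok|_] //=; exact: ok.
have [a [h1 h2 h3 h4 [h5 h6]]] :=
  one_step (B := genA (stage A D)) (stage_rowper adm) (stage_cvg down adm)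
  ge esurj (@gen_base (stage A D)) (stage_dense down adm) BF F0 Tsize.
exists a; split => //.
- move=> v vw gv v0; have [j E] := hen v vw; subst v.
  have [k [n0 hk]] := h5 j; exists k, n0 => n i /hk; move/(_ i).
  by rewrite /F; case: pselect => // nok; case: nok.
- move=> v vw gv; have [j E] := hen v vw; subst v.
  exists j => n k jn kn; have [M M0 hM] := h6 j n k jn kn; exists M => // r rT.
  by apply: hM; rewrite /T; case: pselect.
Qed.

Lemma construction : exists A : R -> U, forall w, admissible w A (A w).
Proof.
exact: (@wf_choice R lt _ btop admissible (omega1_wf lto) admissible_ext admissible_exists).
Qed.

(** * The final algebra: metrizable null sets and the measure that is not a limit *)

Hypothesis task_surj : forall t, exists v, task v = t.
Variable A : R -> U.
Hypothesis A_adm : forall w, admissible w A (A w).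

Let B := genA (stage A setT).

Lemma B_rowper a : B a -> rowper a.
Proof. by apply: stage_rowper => v _; exact: A_adm. Qed.

Lemma B_cvg a : B a -> cvgn (lam^~ a).
Proof. by apply: stage_cvg => // v _; exact: A_adm. Qed.

Lemma B_dense a : B a -> forall e : R, 0 < e ->
  exists2 c, periodic c & mu (bxor a (bcst c)) <= e.
Proof. by apply: stage_dense => // v _; exact: A_adm. Qed.

Lemma B_stage a : B a -> exists w, gen (stage A (below w)) a.
Proof.
move=> /gen_stage[ea|[v _ gv]]; first by exists 0; exact: gen_base.
have [w hw] := omega1_bounded lto (fun=> v); have vw := hw 0%N.
exists w; apply: gen_sub gv => _ [[u uv <-]|->]; apply: gen_in.
  by exists u => //; exact: (omega1_trans lto) uv vw.
by exists v.
Qed.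

(** The sequence [E] is itself a task [v0]. Beyond a stage [w] that follows [v0] and contains all
    the [E k], every generator misses some [E k] up to finitely many rows, so it leaves an
    eventually constant trace there. Hence the countable algebra below [w] gives all traces. *)
Lemma B_null_trace (E : nat -> U) : (forall k, B (E k)) ->
  (forall k, bsub (E k.+1) (E k)) -> mu \o E @ \oo --> (0 : R) ->
  exists S : nat -> U, (forall j, B (S j)) /\
    forall a, B a -> exists k j, band a (E k) = band (S j) (E k).
Proof.
move=> BE Esub E0.
have Emon k l : (k <= l)%N -> bsub (E l) (E k).
  by move=> /subnK <-; elim: (l - k)%N => [//|j IH] x /Esub/IH.
have [v0 hv0] := task_surj (fun t => (E t.1.1 (t.1.2, t.2), [::])).
have EE : task_set v0 = E.
  by apply/funext => k; apply/funext => -[n i]; rewrite /task_set hv0.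
have [u hu] := choice (fun k => B_stage (BE k)).
have [w hw] := omega1_bounded lto (fun n => if n is k.+1 then u k else v0).
have v0w : lt v0 w := hw 0%N; have uw k : lt (u k) w := hw k.+1.
have [en hen] := countable_enum w (omega1_countable lto w).
have [S [gS Ssurj]] : exists e : nat -> U, (forall n, gen (stage A (below w)) (e n)) /\
    forall a, gen (stage A (below w)) a -> exists n, e n = a.
  by apply: gen_enum; exists (A \o en) => _ [v /hen[n <-] <-]; exists n.
exists S; split; first by move=> j; apply: stage_sub (gS j).
suff h a : B a -> exists k s, gen (stage A (below w)) s /\ band a (E k) = band s (E k).
  by move=> a /h[k [s [/Ssurj[j <-] hs]]]; exists k, j.
elim=> {a} [a ea|_ [v _ <-]|a _ [k [s [gs hs]]]|a b _ [k [s [gs hs]]] _ [k' [s' [gs' hs']]]].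
- by exists 0%N, a; split => //; exact: gen_base.
- have [vw|nvw] := pselect (lt v w).
    by exists 0%N, (A v); split => //; apply: gen_in; exists v.
  have wv z : lt z w -> lt z v.
    by move=> zw; have [//|->//|wv] := omega1_total lto v w; exact: (omega1_trans lto) wv.
  have gE k : gen (stage A (below v)) (task_set v0 k).
    by rewrite EE; apply: stage_sub (hu k) => z zu; apply: wv; exact: (omega1_trans lto) (uw k).
  have adm := A_adm v; have := adm_avoid adm (wv _ v0w) gE.
  rewrite EE => /(_ E0)[k [n0 hk]].
  exists k, (band (A v) (E k)); split; last by btaut.
  apply: gen_base; split.
    by apply: rowperI; [exact: (adm_rowper adm)|exact: B_rowper].
  exists (bneg btop); first exact: periodic_bneg periodic_btop.
  by exists n0 => n nn; apply/funext => i; apply/negbTE; exact: hk.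
- exists k, (bneg s); split; first exact: gen_neg.
  apply/funext => x; have := f_equal (fun f => f x) hs; rewrite /band /bneg.
  by case: (a x); case: (s x); case: (E k x).
- exists (k + k')%N, (band s s'); split; first exact: gen_and.
  apply/funext => x; have := f_equal (fun f => f x) hs; have := f_equal (fun f => f x) hs'.
  have := @Emon k (k + k')%N (leq_addr _ _) x; have := @Emon k' (k + k')%N (leq_addl _ _) x.
  rewrite /band; case: (E (k + k')%N x); rewrite ?andbF// => /(_ isT) -> /(_ isT) ->.
  by rewrite !andbT => -> ->.
Qed.

Lemma B_good (m : U -> R) : fadd B m -> good B m.
Proof. exact: (all_good (B := B) B_rowper B_cvg (@gen_base _) B_dense B_null_trace). Qed.

Let C (n : nat) : U := fun x => x.1 == n.
Let D n : U := fun x => (x.1 < n)%N.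

Let evconst_zero (a : U) n0 : rowper a -> (forall n i, (n0 <= n)%N -> ~~ a (n, i)) ->
  evconst a.
Proof.
move=> ra h; split => //; exists (bneg btop); first exact: periodic_bneg periodic_btop.
by exists n0 => n /h hn; apply/funext => i; apply/negbTE; exact: hn.
Qed.

Let BC n : B (C n).
Proof.
apply: gen_base; apply: (evconst_zero (n0 := n.+1)) => [k|k i nk]; first by exists 1%N.
by rewrite /C /= gtn_eqF.
Qed.

Let BD n : B (D n).
Proof.
apply: gen_base; apply: (evconst_zero (n0 := n)) => [k|k i nk]; first by exists 1%N.
by rewrite /D /= -leqNgt.
Qed.

Let Bres i M : (0 < M)%N -> B (bcst (residue i M)).
Proof.
by move=> M0; apply: gen_base; apply: evconst_bcst; exists M; exact: per_residue.
Qed.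

Lemma point_fadd (p : stone B) : fadd B (fun a => (p a)%:R : R).
Proof.
split => [a _|a b Ba Bb]; first by rewrite ler0n.
have BN := balgN Bb; rewrite -natrD; congr (_%:R).
by rewrite !stptI// stptN//; case: (p a); case: (p b).
Qed.

(** [fadd_residues] is applied to the 0-1 measure of [p]. *)
Lemma point_residue (p : stone B) a M : (0 < M)%N -> p a ->
  exists i, p (band a (bcst (residue i M))).
Proof.
move=> M0 pa; apply: contrapT => nex.
have := fadd_residues (B := B) (@gen_base _) (point_fadd p) M0 (stpt_sub pa).
rewrite pa big1 => [|i _]; first by move/eqP; rewrite oner_eq0.
by rewrite (_ : p _ = false)//; apply/negP => h; apply: nex; exists i.
Qed.

Lemma point_sub (p : stone B) a b : B b -> bsub a b -> p a -> p b.
Proof.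
move=> Bb /bsubE ab pa; have Ba := stpt_sub pa.
by move: pa; rewrite -ab stptI// => /andP[].
Qed.

Lemma point_D (p : stone B) n : p (D n) -> exists k, p (C k).
Proof.
elim: n => [|n IH].
  have -> : D 0%N = bneg btop by apply/funext.
  by rewrite stpt0.
have [h|h] := boolP (p (D n)); first by move=> _; exact: IH.
move=> hn; exists n; apply: (@point_sub p (band (D n.+1) (bneg (D n)))) => //.
  by move=> x; rewrite /band /bneg /D /C -leqNgt ltnS => /andP[h1 h2]; rewrite eqn_leq h1.
have BN := balgN (BD n).
by rewrite stptI ?stptN ?hn.
Qed.

(** A point in the [n]-th row is a profinite integer, of which [rho] reads the residue mod [M]; for
    other points the value is the default 0. *)
Let rho (p : stone B) (n M : nat) : nat := xget 0%N [set i | p (band (C n) (bcst (residue i M)))].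

Let chi (p : stone B) (m : nat) : nat := xget 0%N [set i | p (bcst (residue i m`!))].

Let rhoP (p : stone B) n M : (0 < M)%N -> p (C n) ->
  p (band (C n) (bcst (residue (rho p n M) M))).
Proof. by move=> M0 /(point_residue M0) ex; exact: (xgetPex 0%N ex). Qed.

Let chiP (p : stone B) m : p (bcst (residue (chi p m) m`!)).
Proof.
have [i hi] := point_residue (fact_gt0 m) (stptT p).
apply: (xgetPex 0%N (_ : exists j, [set i | p (bcst (residue i m`!))] j)).
exists i => /=; apply: point_sub hi; first exact/Bres/fact_gt0.
by move=> x /andP[].
Qed.

(** On a suitable subsequence [nu] the mass of [nu k] on the first [k] rows is at most 1/8. Some
    [A w] contains, for large [k], no point of [nu k] outside these rows, so it gets mass at most
    1/8 although [mu (A w)] is at least 1/2. *)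
Lemma mu_not_limit (s : nat -> seq (R * stone B)) : (forall k, nonneg_weights (s k)) ->
  ~ (forall a, B a -> (fun k => fincomb (s k) a) @ \oo --> mu a).
Proof.
move=> s0 scv.
have e8 : (0 : R) < 8^-1 by rewrite invr_gt0.
have exphi k : exists l, (k <= l)%N /\ fincomb (s l) (D k) <= 8^-1.
  have muD : mu (D k) = 0.
    apply/cvg_lim => //; apply: cvg_near_cst; exists k => // n /= kn.
    rewrite -[RHS](fadd0 (lam_fadd R n)); congr dens; apply/funext => i.
    by apply/negbTE; rewrite /row /D /= -leqNgt.
  have /cvgrPdist_le /(_ _ e8) [N _ hN] := scv _ (BD k).
  exists (maxn k N); split; first exact: leq_maxl.
  have := hN (maxn k N) (leq_maxr _ _); rewrite /= muD sub0r normrN.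
  by move=> /(le_trans _); apply; exact: ler_norm.
have [phi hphi] := choice exphi.
pose nu k := s (phi k).
(* The task [vT] lists the points of [nu k] in each row, by their residues. *)
have [vT hvT] := task_surj (fun t =>
  (false, [seq rho x.2 t.1.2 t.2 | x : R * stone B <- nu t.1.1 & x.2 (C t.1.2)])).
(* The task [vE p] is the sequence of residue classes mod [m!] that contain [p], of [mu]-measure
   [1 / m!]; it serves for the points outside all rows. *)
have [vE hvE] := choice (fun p : stone B => task_surj (fun t =>
  (residue (chi p t.1.1) (t.1.1)`! t.2, [::]))).
pose pt k j := (nth (0, evpt B (0, 0)%N) (nu k) j).2.
(* An index beyond [vT] and beyond the tasks of the countably many points that occur in [nu]. *)
have [w hw] := omega1_bounded lto (fun n => if n is m.+1 then
  if unpickle m is Some kj then vE (pt kj.1 kj.2) else vT else vT).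
have vTw : lt vT w := hw 0%N.
have vEw k j : lt (vE (pt k j)) w by have := hw (pickle (k, j)).+1; rewrite pickleK.
have adm := A_adm w.
have BA : B (A w) by apply: gen_in; exists w.
have [i0 hi0] : exists i0, forall n k, (i0 <= n)%N -> (k <= n)%N -> exists2 M, (0 < M)%N &
      forall r, r \in task_list vT k n M -> forall i, A w (n, i) -> i <> r %[mod M].
  apply: (adm_miss adm vTw) => k n M.
  by rewrite /task_list hvT !size_map.
(* [A w] meets one of the residue classes containing the point in finitely many rows only, so a
   point of [A w] would lie in one of these rows. *)
have out k j : (forall n, ~ pt k j (C n)) -> ~ pt k j (A w).
  set p := pt k j => pL pA.
  have EE : task_set (vE p) = fun m => bcst (residue (chi p m) m`!).
    by apply/funext => m; apply/funext => x; rewrite /task_set hvE.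
  have gE m : gen (stage A (below w)) (task_set (vE p) m).
    rewrite EE; apply: gen_base; apply: evconst_bcst.
    by exists m`!; apply: per_residue; exact: fact_gt0.
  have E0 : mu \o task_set (vE p) @ \oo --> (0 : R).
    rewrite EE; apply: (cvg_near0 (C := 2)) => m; rewrite subr0 /= mu_bcst.
    rewrite dens_residue ?fact_gt0// ger0_norm ?invr_ge0//.
    exact: inv_fact_le.
  have [m [n0 hm]] := adm_avoid adm (vEw k j) gE E0.
  have pE : p (task_set (vE p) m) by rewrite EE; exact: chiP.
  have BEm := stpt_sub pE.
  have pAE : p (band (A w) (task_set (vE p) m)) by rewrite stptI// pA pE.
  have [|n] := @point_D p n0; last exact: pL.
  apply: point_sub pAE => // -[n i] h; rewrite /D /= ltnNge; apply/negP => nn.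
  by have := hm n i nn; rewrite -[_ && _]/(band _ _ (n, i)) h.
have key k : (i0 <= k)%N -> fincomb (nu k) (A w) <= fincomb (nu k) (D k).
  move=> ik; rewrite /fincomb big_seq [leRHS]big_seq; apply: ler_sum => x xs.
  apply: ler_wpM2l; first by move/allP : (s0 (phi k)); apply.
  rewrite ler_nat; case: (boolP (x.2 (A w))) => // pA; rewrite lt0b.
  have xpt : x.2 = pt k (index x (nu k)) by rewrite /pt nth_index.
  have [[n pn]|pL] := pselect (exists n, x.2 (C n)); last first.
    by exfalso; apply: (out k (index x (nu k))); rewrite -xpt// => n pn; apply: pL; exists n.
  have [nk|kn] := ltnP n k.
    apply: point_sub pn => // y; rewrite /C /D => /eqP ->; exact: nk.
  (* In the rows from [k] on, [A w] avoids the residue class of the point modulo a suitable [M]. *)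
  exfalso; have [M M0 hM] := hi0 n k (leq_trans ik kn) kn.
  have pr := rhoP M0 pn; have Br := Bres (rho x.2 n M) M0.
  have := stptI x.2 BA (balgI (BC n) Br); rewrite pA pr /=.
  have -> : band (A w) (band (C n) (bcst (residue (rho x.2 n M) M))) = bneg btop.
    apply/funext => -[n' i]; rewrite /band /C /bcst /residue /=; apply/negP.
    move=> /and3P[Ai /eqP E /eqP ir]; subst n'.
    apply: hM Ai ir; rewrite /task_list hvT /=; apply/mapP; exists x => //.
    by rewrite mem_filter pn.
  by rewrite stpt0.
have /cvgrPdist_le /(_ _ e8) [N _ hN] := scv _ BA.
pose k := maxn i0 N.
have [kphi h1] := hphi k.
have h2 := key k (leq_maxl _ _).
have h3 := hN (phi k) (leq_trans (leq_maxr _ _) kphi).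
have h4 := adm_half adm.
move: h3; rewrite /= ler_norml -/(nu k) => /andP[_ h3].
have : fincomb (nu k) (A w) <= 8^-1 by exact: le_trans h2 h1.
lra.
Qed.

End Construction.

Unset Implicit Arguments.

Theorem theorem2p7 (R : realType) (hCH : CH R) :
  exists K : topologicalType,
    compact [set: K] /\ hausdorff_space K /\
    Seq1 R K (coDelta R K) <> SeqCl R K (coDelta R K) /\
    SeqCl R K (coDelta R K) = PK R K.
Proof.
have [lt lto] := CH_omega1 hCH.
have [task task_surj] := @real_surj_seq R (nat * nat * nat)%type (bool * seq nat)%type
  (false, [::]).
have [A A_adm] := construction lto task.
exists (stone (genA (stage A setT))).
split; first exact: stone_compact.
split; first exact: stone_hausdorff.
apply: (stone_reduction (mu := mu R)).
- by move=> m; exact: (B_good lto task_surj A_adm).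
- by apply: (stage_fadd lto) => // v _; exact: A_adm.
- exact: etrans (mu_bcst R btop) (dens_btop R).
- exact: (mu_not_limit lto task_surj A_adm).
Qed.
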